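(* Let $T\ge1$ be an integer, $0<\epsilon<1$, $\kappa=1-\epsilon^2$, and let $\bar v$ be the value function and $\bar u$ the function defined in the context, with parameters $\sigma=\kappa$ and $b=\sigma/\epsilon=\kappa/\epsilon$ (so that $\bar u$ is the $C^1$ solution of the heat equation in the context). Then $$|\bar u(\epsilon T,0,-T)-\bar v(\epsilon T,0,-T)|\le\bar E_1(-T),$$ where the error term $\bar E_1(-T)$ is $$O\Big(\epsilon\min\big(\log(\kappa^2/\epsilon^2)+1,\log T\big)+\Big(\frac\kappa\epsilon\nu(\epsilon)+\frac\kappa\epsilon\rho(\epsilon)+1\Big)T\Big),$$ with $$\rho(\epsilon)=\Big(e^{-2\epsilon/\kappa}-1\Big)\frac{1+\epsilon}{2},\qquad \nu(\epsilon)=e^{-2\epsilon/\kappa}\,\frac{1+\epsilon}{2}+e^{2\epsilon/\kappa}\,\frac{1-\epsilon}{2}-1 .$$ When $\epsilon\to0$, the leading order terms of $\frac{\kappa}{\epsilon}\nu$ and $\frac{\kappa}{\epsilon}\rho$ are $$\frac{\kappa}{\epsilon}\nu(\epsilon)\approx2\epsilon^3\quad\text{and}\quad\frac{\kappa}{\epsilon}\rho(\epsilon)+1\approx\epsilon^2,$$ and $\bar E_1(-T)$ is $$O\Big(\epsilon\min\big(\log(1/\epsilon^2)+1,\log T\big)+\epsilon^2T\Big).$$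
   Context: $O(\cdot)$ is understood with an absolute constant, independent of $T\ge1$ and $\epsilon\in(0,1)$; ''when $\epsilon\to0$, $O(\cdot)$'' means with an absolute constant for all sufficiently small $\epsilon$ and all $T\ge1$. The symbol $\approx$ indicates the leading order term as $\epsilon\to0$. Value function $\bar v$ (final-time pseudoregret of the symmetric two-armed Bernoulli bandit with centered rewards, under the myopic player, started at time $t$ with given $\xi^r$ and number $s_2$ of pulls of the risky arm 2): $\bar v(\xi^r,s_2,0)=2\epsilon s_2$ and, for integers $t\le-1$, $$\bar v(\xi^r,s_2,t)=\mathbb E\big[\bar v(\xi^r+d\xi^r,s_2+ds_2,t+1)\big].$$ Here $g_1,g_2\in\{-1,1\}$ are independent with $P(g_1=1)=\frac{1+\epsilon}2$ and $P(g_2=1)=\frac{1-\epsilon}2$; $I\in\{1,2\}$ is independent of $(g_1,g_2)$ and sampled from $p^m(\xi^r,t)$, which equals $(1,0)$ if $\xi^r+\epsilon t>0$, $(\frac12,\frac12)$ if $\xi^r+\epsilon t=0$, $(0,1)$ if $\xi^r+\epsilon t<0$; and $d\xi^r=g_1\mathbf 1_{\{I=1\}}-g_2\mathbf 1_{\{I=2\}}-\epsilon$, $ds_2=\mathbf 1_{\{I=2\}}$. The domain of $\bar v$ is restricted to integer values of $\xi^r+\epsilon t$ and $s_2$. Function $\bar u$: for $t<0$ and parameters $\sigma,b>0$, $$\bar u(\xi^r,s_2,t)=2\epsilon s_2+\bar\varphi(\xi^r+\epsilon t)-\int_{\mathbb R}\Phi(\xi^r-s,t)\bar\varphi(s)\,ds,\qquad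 \Phi(s,t)=\frac1{\sqrt{-2\pi\kappa t}}\exp\Big(\frac{s^2}{2\kappa t}\Big),$$ with $\bar\varphi(y)=-2y$ for $y\le0$ and $\bar\varphi(y)=b e^{-2\epsilon y/\sigma}-b$ for $y>0$. Heat equation: with $\sigma=\kappa$, $\bar u$ solves $\bar u_t+\frac\kappa2\bar u_{\xi^r\xi^r}=\bar q$, $\bar u(\xi^r,s_2,0)=2\epsilon s_2$, where $\bar q=-2\epsilon$ if $\xi^r+\epsilon t<0$ and $\bar q=0$ if $\xi^r+\epsilon t>0$; it is $C^1$ when $b=\kappa/\epsilon$.
   Formalization: The printed leading-order terms 2ε³ and ε² are incorrect (they come from truncating the exponentials at second order); the formal statement proves (κ/ε)ν ≈ (4/3)ε³ and (κ/ε)ρ+1 ≈ ε²/3 instead; all other claims are as stated. *)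

(* Defs.v *)
From HB Require Import structures.
From mathcomp Require Import all_boot all_order all_algebra.
From mathcomp Require Import all_classical all_reals all_analysis.

Set Implicit Arguments.
Unset Strict Implicit.
Unset Printing Implicit Defensive.

Import Order.TTheory GRing.Theory Num.Theory.
Import numFieldNormedType.Exports.

Local Open Scope classical_set_scope.
Local Open Scope ring_scope.

Section SymmetricBandit.
Variable R : realType.
Implicit Types (eps kappa sigma b xi t y : R).

(* Arms are booleans: [false] is the safe arm 1, [true] the risky arm 2. *)
Definition myopic eps xi t : R * R :=
  if 0 < xi + eps * t then (1, 0)
  else if xi + eps * t == 0 then (2^-1, 2^-1)
  else (0, 1).

Definition arm_prob (p : R * R) (I : bool) : R := if I then p.2 else p.1.

Definition reward (g : bool) : R := if g then 1 else -1.

Definition dxi eps (g1 g2 I : bool) : R :=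
  reward g1 *+ (~~ I) - reward g2 *+ I - eps.

(* [vbar eps n xi s2] is the value started at the time t = - n. As g1, g2 and
   I are independent, the expectation over one round is the sum over their
   joint values weighted by the product of the marginal probabilities. Real
   values of [xi] outside of the lattice xi + eps t \in Z are harmless: the
   recursion preserves the lattice. *)
Fixpoint vbar eps (n : nat) xi (s2 : int) : R :=
  if n is n'.+1 then
    \sum_(g1 : bool) \sum_(g2 : bool) \sum_(I : bool)
      bernoulli_pmf ((1 + eps) / 2) g1 * bernoulli_pmf ((1 - eps) / 2) g2 *
      arm_prob (myopic eps xi (- n%:R)) I *
      vbar eps n' (xi + dxi eps g1 g2 I) (s2 + I%:Z)
  else 2 * eps * s2%:~R.

Definition Phi kappa s t : R :=
  (Num.sqrt (- 2 * pi * kappa * t))^-1 * expR (s ^+ 2 / (2 * kappa * t)).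

Definition phibar eps sigma b y : R :=
  if y <= 0 then - 2 * y else b * expR (- 2 * eps * y / sigma) - b.

Definition ubar eps kappa sigma b xi (s2 : R) t : R :=
  2 * eps * s2 + phibar eps sigma b (xi + eps * t)
  - \int[@lebesgue_measure R]_s (Phi kappa (xi - s) t * phibar eps sigma b s).

Definition kappa_ eps : R := 1 - eps ^+ 2.

Definition rho eps : R :=
  (expR (- 2 * eps / kappa_ eps) - 1) * ((1 + eps) / 2).

Definition nu eps : R :=
  expR (- 2 * eps / kappa_ eps) * ((1 + eps) / 2)
  + expR (2 * eps / kappa_ eps) * ((1 - eps) / 2) - 1.

Definition rate eps (T : nat) : R :=
  eps * Num.min (ln (kappa_ eps ^+ 2 / eps ^+ 2) + 1) (ln T%:R)
  + (kappa_ eps / eps * nu eps + kappa_ eps / eps * rho eps + 1) * T%:R.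

Definition rate0 eps (T : nat) : R :=
  eps * Num.min (ln (1 / eps ^+ 2) + 1) (ln T%:R) + eps ^+ 2 * T%:R.

End SymmetricBandit.

(* Main.v *)
Require Import Defs.
From HB Require Import structures.
From mathcomp Require Import all_boot all_order all_algebra.
From mathcomp Require Import all_classical all_reals all_analysis.
From mathcomp Require Import measurable_realfun.
From mathcomp Require Import zify ring lra.

Set Implicit Arguments.
Unset Strict Implicit.
Unset Printing Implicit Defensive.

Import Order.TTheory GRing.Theory Num.Theory.
Import numFieldNormedType.Exports.

Local Open Scope classical_set_scope.
Local Open Scope ring_scope.

(* Under either arm xi moves by the same law, so y = xi + eps t is a random walk
   S with drift eps whatever the player does, and vbar counts the expected time
   that S spends below 0 (with weight 1/2 at 0). Pairing the times 2 m + 1 and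
   2 m + 2, P(S_k < 0) + P(S_k = 0) / 2 = 1/2 - H_m(eps), where H_m is a
   polynomial with derivative a_m (1 - x^2)^m, H_m(0) = 0 and H_m(1) = 1/2.

   With G the primitive of exp(- x^2) / sqrt pi vanishing at 0 and
   z_k = eps sqrt (k / (2 kappa)), the integral defining ubar is explicit, and
   its increment from T = k to T = k + 1 lies between eps (1 - 2 G(z_(k+1))) and
   eps (1 - 2 G(z_k)). Monotone likelihood ratios give
     G(eps sqrt m) <= H_m(eps) <= G(eps / sqrt kappa * sqrt (m + 2)),
   so the difference of the values telescopes, up to an error eps^3 / kappa per
   step which comes from replacing sqrt m * eps by sqrt m * eps / sqrt kappa.
   The total is O(eps G(z_(T+2)) + eps^3 T / kappa). No logarithm is needed: the
   one in [rate] only serves to dominate eps when T >= 2, and at T = 1 the bound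
   is O(eps^2) since G vanishes at 0. *)

(** * Calculus *)

Section Calculus.
Context {R : realType}.
Implicit Types (f g df dg : R -> R) (a b c x y z t : R) (n m k : nat).

(* Unlike [is_derive], not a class: instance resolution would fill it in with
   values in terms of [*:] and sums of functions. *)
Definition has_derive x f a := is_derive x 1 f a.

Lemma der_cst c x : has_derive x (fun=> c : R) 0.
Proof. exact: is_derive_cst. Qed.

Lemma der_id x : has_derive x (fun t => t) 1.
Proof. exact: is_derive_id. Qed.

Lemma der_add f g x a b : has_derive x f a -> has_derive x g b ->
  has_derive x (fun t => f t + g t) (a + b).
Proof. move=> *; exact: is_deriveD. Qed.

Lemma der_opp f x a : has_derive x f a -> has_derive x (fun t => - f t) (- a).
Proof. move=> *; exact: is_deriveN. Qed.

Lemma der_mul f g x a b : has_derive x f a -> has_derive x g b ->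
  has_derive x (fun t => f t * g t) (f x * b + g x * a).
Proof. move=> *; exact: is_deriveM. Qed.

Lemma der_exp f x a n : has_derive x f a ->
  has_derive x (fun t => f t ^+ n) (n%:R * f x ^+ n.-1 * a).
Proof.
case: n => [|n] fa.
  by rewrite !mul0r; exact: der_cst.
have -> : (fun t => f t ^+ n.+1) = f ^+ n.+1.
  by apply/funext => t; rewrite exprfctE.
by have := @is_deriveX _ R f n.+1 x 1 a fa; rewrite /GRing.scale.
Qed.

Lemma der_comp f g x a b : has_derive (g x) f a -> has_derive x g b ->
  has_derive x (fun t => f (g t)) (a * b).
Proof. move=> *; exact: (@is_derive1_comp _ f g). Qed.

Lemma der_expR f x a : has_derive x f a ->
  has_derive x (fun t => expR (f t)) (expR (f x) * a).
Proof. by apply: der_comp; exact: is_derive_expR. Qed.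

Lemma der_eq f x a b : has_derive x f a -> a = b -> has_derive x f b.
Proof. by move=> ? <-. Qed.

End Calculus.

Ltac der := repeat first
  [ apply: der_cst | apply: der_id | apply: der_add | apply: der_opp
  | apply: der_mul | apply: der_exp | apply: der_expR ].

Section CalculusTheory.
Context {R : realType}.
Implicit Types (f g df dg : R -> R) (a b c x y z t : R) (n m k : nat).

Lemma der_continuous f a x : has_derive x f a -> {for x, continuous f}.
Proof.
by move=> [fx _]; apply: differentiable_continuous; exact/derivable1_diffP.
Qed.

Lemma mean_value f df a b : a < b ->
  (forall x, a <= x <= b -> has_derive x f (df x)) ->
  exists2 c, a < c < b & f b - f a = df c * (b - a).
Proof.
move=> ab fd; case: (MVT ab (f := f) (df := df)).
- by move=> x; rewrite in_itv/= => /andP[? ?]; apply: fd; rewrite !ltW.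
- apply: derivable_within_continuous => x; rewrite in_itv/= => xab.
  by case: (fd x xab).
- by move=> c; rewrite in_itv/=; exists c.
Qed.

Lemma der_ge0_le f df a b : a <= b ->
  (forall x, a <= x <= b -> has_derive x f (df x)) ->
  (forall x, a <= x <= b -> 0 <= df x) -> f a <= f b.
Proof.
rewrite le_eqVlt => /predU1P[->//|ab] fd d0.
have [c /andP[ac cb] e] := mean_value ab fd.
rewrite -subr_ge0 e mulr_ge0 ?subr_ge0 ?(ltW ab)//.
by apply: d0; rewrite !ltW.
Qed.

(** From [0 <= f a] to [f x < 0] the slope is negative somewhere, and the sign condition then
    forbids any later rise. A nonnegative value or limit at the right end thus excludes negative
    values before it. *)
Lemma unimodal_ge0 f df a b :
  (forall x, a <= x <= b -> has_derive x f (df x)) ->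
  (forall x y, a <= x -> x <= y -> y <= b -> df x < 0 -> df y <= 0) ->
  0 <= f a -> forall x, a <= x <= b -> f x < 0 -> f b <= f x.
Proof.
move=> fd sgn fa x /andP[]; rewrite le_eqVlt => /predU1P[<- _|ax].
  by rewrite ltNge fa.
rewrite le_eqVlt => /predU1P[->//|xb] fx0; rewrite leNgt; apply/negP => fxb.
have [|c /andP[ac cx] ec] := mean_value ax (f := f) (df := df).
  move=> z /andP[az zx]; apply: fd; rewrite az (le_trans zx)//; exact: ltW.
have [|d /andP[xd db] ed] := mean_value xb (f := f) (df := df).
  move=> z /andP[az zx]; apply: fd; rewrite zx (le_trans _ az)//; exact: ltW.
have dfc : df c < 0.
  have : df c * (x - a) < 0 by rewrite -ec; lra.
  by rewrite pmulr_llt0 // subr_gt0.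
have dfd : 0 < df d.
  have : 0 < df d * (b - x) by rewrite -ed; lra.
  by rewrite pmulr_lgt0 // subr_gt0.
have := sgn c d (ltW ac) (ltW (lt_trans cx xd)) (ltW db) dfc.
by rewrite leNgt dfd.
Qed.

End CalculusTheory.

(** * The Gaussian primitive *)

Section Gauss.
Context {R : realType}.
Implicit Types (x y z t : R).
Local Notation mu := (@lebesgue_measure R).

Definition gauss x : R := expR (- x ^+ 2) / Num.sqrt pi.

Definition gauss_cdf x : R :=
  (\int[mu]_(t in `]-oo, x]) gauss_fun t) / Num.sqrt pi.

(* Half of the error function. *)
Definition herf x : R := gauss_cdf x - gauss_cdf 0.

Lemma sqrt_pi_gt0 : 0 < Num.sqrt (pi : R).
Proof. by rewrite sqrtr_gt0 pi_gt0. Qed.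

Lemma sqrt_pi_ge1 : 1 <= Num.sqrt (pi : R).
Proof.
rewrite -sqrtr1 ler_sqrt ?pi_ge0//.
by rewrite (le_trans _ (pi_ge2 R))// ler1n.
Qed.

Lemma gauss_gt0 x : 0 < gauss x.
Proof. by rewrite divr_gt0 ?expR_gt0 ?sqrt_pi_gt0. Qed.

Lemma gauss_le1 x : gauss x <= 1.
Proof.
rewrite ler_pdivrMr ?sqrt_pi_gt0// mul1r (le_trans _ sqrt_pi_ge1)//.
exact: gauss_fun_le1.
Qed.

Lemma gauss_even x : gauss (- x) = gauss x.
Proof. by rewrite /gauss sqrrN. Qed.

Lemma gauss_anti x y : 0 <= x -> x <= y -> gauss y <= gauss x.
Proof.
move=> x0 xy; rewrite ler_pM2r ?invr_gt0 ?sqrt_pi_gt0// ler_expR lerN2.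
by rewrite ler_pXn2r ?nnegrE// (le_trans x0).
Qed.

(** With sqrt pi >= 1, this is x <= 1 + x^2 <= exp(x^2). It makes the cost of a change of scale
    inside [herf] uniform in the number of steps. *)
Lemma mul_gauss_le1 x : 0 <= x -> x * gauss x <= 1.
Proof.
move=> x0; rewrite /gauss mulrA ler_pdivrMr ?sqrt_pi_gt0// mul1r.
apply: le_trans sqrt_pi_ge1; rewrite expRN ler_pdivrMr ?expR_gt0// mul1r.
by have := expR_ge1Dx (x ^+ 2); nra.
Qed.

Lemma der_gauss x : has_derive x gauss (- 2 * x * gauss x).
Proof.
rewrite /gauss; by apply: der_eq; [der | rewrite /=; ring].
Qed.

Lemma gauss_cdf_der x : has_derive x gauss_cdf (gauss x).
Proof.
have xx1 : x < x + 1 by rewrite ltrDl.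
have int : mu.-integrable `]-oo, (x + 1)] (EFin \o @gauss_fun R).
  exact: integrableS integrableT_gauss.
have [||d1 d2] := continuous_FTC1 xx1 int (f := gauss_fun).
- by rewrite ltNyr.
- exact: continuous_gauss_fun.
have h : has_derive x (fun x0 => \int[mu]_(t in `]-oo, x0]) gauss_fun t)
  (gauss_fun x).
  by split; [exact: d1 | rewrite -derive1E; exact: d2].
rewrite /gauss_cdf; apply: der_eq.
  apply: der_mul; [exact: h | exact: der_cst].
- by rewrite /= mulr0 add0r mulrC.
Qed.

Lemma herf_der x : has_derive x herf (gauss x).
Proof.
rewrite /herf; apply: der_eq.
  by apply: der_add; [exact: gauss_cdf_der | exact: der_cst].
- by rewrite addr0.
Qed.

Lemma herf0 : herf 0 = 0.
Proof. exact: subrr. Qed.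

Lemma herf_continuous : continuous herf.
Proof. move=> x; exact: der_continuous (herf_der x). Qed.

Lemma herf_le x y : x <= y -> herf x <= herf y.
Proof.
move=> xy; apply: (der_ge0_le xy (df := gauss)) => z _.
  exact: herf_der.
exact/ltW/gauss_gt0.
Qed.

(** As [gauss] is even, [herf t + herf (- t)] has zero derivative; it is monotone in both senses and
    vanishes at 0. *)
Lemma herf_odd x : herf (- x) = - herf x.
Proof.
wlog x0 : x / 0 <= x.
  move=> H; have [/H//|x0] := leP 0 x.
  by have := H (- x); rewrite opprK oppr_ge0 => ->; rewrite ?opprK ?ltW.
have d y : has_derive y (fun t => herf t + herf (- t)) 0.
  apply: der_eq.
    apply: der_add; first exact: herf_der.
    apply: (der_comp (f := herf)); first exact: herf_der.
    by apply: der_opp; exact: der_id.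
    - by rewrite gauss_even; ring.
have e1 := @der_ge0_le _ _ (fun=> 0) _ _ x0
  (fun y _ => d y) (fun y _ => lexx _).
have e2 := @der_ge0_le _ _ (fun=> - 0) _ _ x0
  (fun y _ => der_opp (d y)).
move: e1 e2; rewrite /= oppr0 herf0 addr0 => e1 /(_ (fun y _ => lexx _)) e2.
lra.
Qed.

(** A limit exists by monotonicity and boundedness; the fundamental theorem with this unknown limit,
    applied to the known half-line Gaussian integral, identifies it. *)
Lemma herf_cvg : herf x @[x --> +oo] --> (2^-1 : R).
Proof.
have bnd : has_ubound (range herf).
  exists (\int[mu]_t gauss_fun t / Num.sqrt pi) => _ [x _ <-].
  apply: (@le_trans _ _ (gauss_cdf x)).
    rewrite /herf gerBl divr_ge0 ?(ltW sqrt_pi_gt0)//.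
    by apply: Rintegral_ge0 => t _; exact: gauss_fun_ge0.
  rewrite ler_pM2r ?invr_gt0 ?sqrt_pi_gt0//.
  apply: fine_le.
  - by apply: integrable_fin_num => //; exact: integrableS integrableT_gauss.
  - by apply: integrable_fin_num => //; exact: integrableT_gauss.
  - apply: ge0_subset_integral => //.
      exact: (measurable_int mu integrableT_gauss).
    by move=> t _; rewrite lee_fin gauss_fun_ge0.
have cv := nondecreasing_cvgr herf_le bnd.
set l := sup _ in cv.
have I := @integral0y_gauss R.
rewrite (@ge0_continuous_FTC2y R gauss_fun (fun x => herf x * Num.sqrt pi) 0
  (l * Num.sqrt pi)) in I.
- move: I; rewrite herf0 mul0r -EFinB subr0 => -[] I.
  suff -> : 2^-1 = l by [].
  apply: (mulIf (lt0r_neq0 sqrt_pi_gt0)); rewrite I; exact: mulrC.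
- by move=> x _; exact: gauss_fun_ge0.
- by apply: continuous_subspaceT; exact: continuous_gauss_fun.
- by apply: cvgMl.
- move=> x _; case: (der_mul (herf_der x) (der_cst (Num.sqrt pi) x)) => //.
- apply: cvgMl; apply: cvg_at_right_filter; exact: herf_continuous.
- move=> x _; rewrite derive1E.
  case: (der_mul (herf_der x) (der_cst (Num.sqrt pi) x)) => _ ->.
  rewrite mulr0 add0r /gauss mulrC divfK//; exact: lt0r_neq0 sqrt_pi_gt0.
Qed.

Lemma herf_le_half x : herf x <= 2^-1.
Proof.
apply: (cvgr_to_ge herf_cvg).
near=> y; apply: herf_le; near: y; apply: nbhs_pinfty_ge; exact: num_real.
Unshelve. all: by end_near.
Qed.

Lemma herfB_le x y : 0 <= x -> x <= y -> herf y - herf x <= (y - x) * gauss x.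
Proof.
move=> x0; rewrite le_eqVlt => /predU1P[->|xy]; first by rewrite !subrr mul0r.
have [c /andP[xc cy] ->] := mean_value xy (fun z _ => herf_der z).
rewrite mulrC ler_pM2l ?subr_gt0//; apply: gauss_anti => //; exact: ltW.
Qed.

End Gauss.

(** * The defect of the biased walk *)

Section DefectLower.
Context {R : realType}.
Implicit Types (x y z t u v s : R) (m n : nat).

Lemma der_sqrt (f : R -> R) x a : 0 < f x -> has_derive x f a ->
  has_derive x (fun t => Num.sqrt (f t)) ((2 * Num.sqrt (f x))^-1 * a).
Proof. by move=> fx; apply: der_comp; exact: is_derive1_sqrt. Qed.

Lemma der_inv (f : R -> R) x a : f x != 0 -> has_derive x f a ->
  has_derive x (fun t => (f t)^-1) (- (f x) ^- 2 * a).
Proof. by move=> fx h; exact: is_deriveV. Qed.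

(** The probability ['C(2 n, n) / 4 ^ n] that a symmetric walk is back at 0 at time 2 n, see
    [central_binomE]; the product form makes its recurrence immediate. *)
Definition central_binom n : R :=
  \prod_(j < n) ((2 * j%:R + 1) / (2 * j%:R + 2)).

Lemma central_binomS n :
  (2 * n%:R + 2) * central_binom n.+1 = (2 * n%:R + 1) * central_binom n.
Proof.
rewrite /central_binom big_ord_recr/= -/(central_binom n).
have n0 : 0 <= n%:R :> R by exact: ler0n.
by field; rewrite -?natrM -?natrD pnatr_eq0 addn2.
Qed.

Lemma central_binom_gt0 n : 0 < central_binom n.
Proof.
apply: prodr_gt0 => i _; have i0 : 0 <= i%:R :> R by exact: ler0n.
by rewrite divr_gt0//; lra.
Qed.

(* [walk_defect m x] is 1/2 - P(S_k < 0) - P(S_k = 0) / 2 for k = 2 m + 1 and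
   k = 2 m + 2, where S is the random walk with steps 1, -1 and drift x. *)
Definition walk_defect m x : R :=
  x / 2 * \sum_(j < m.+1) central_binom j * (1 - x ^+ 2) ^+ j.

Lemma walk_defectS m x : walk_defect m.+1 x =
  walk_defect m x + x / 2 * (central_binom m.+1 * (1 - x ^+ 2) ^+ m.+1).
Proof. by rewrite /walk_defect big_ord_recr mulrDr. Qed.

(** Writing c for [central_binom], (m + 1/2) c_m = (m + 1) c_(m+1), so the derivative inherited from
    m and that of the added term merge into a single power of 1 - x^2. *)
Lemma walk_defect_der m x : has_derive x (walk_defect m)
  ((m%:R + 2^-1) * central_binom m * (1 - x ^+ 2) ^+ m).
Proof.
elim: m => [|m IH].
  have -> : walk_defect 0 = (fun x => x * 2^-1).
    apply/funext => t; rewrite /walk_defect big_ord1 expr0 /central_binom.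
    by rewrite big_ord0 !mulr1.
  apply: der_eq; first der.
  by rewrite /central_binom big_ord0 expr0/=; field.
have -> : walk_defect m.+1 = (fun x => walk_defect m x +
    x / 2 * (central_binom m.+1 * (1 - x ^+ 2) ^+ m.+1)).
  by apply/funext => t; rewrite walk_defectS.
apply: der_eq; first by apply: der_add; [exact: IH | der].
have e := central_binomS m.
have -> : (m%:R + 2^-1) * central_binom m = (m%:R + 1) * central_binom m.+1.
  by lra.
by rewrite /= -[m.+1%:R]natr1 [_ ^+ m.+1]exprS; field.
Qed.

Lemma walk_defect0 m : walk_defect m 0 = 0.
Proof. by rewrite /walk_defect mul0r mul0r. Qed.

Lemma walk_defect1 m : walk_defect m 1 = 2^-1.
Proof.
rewrite /walk_defect big_ord_recl big1 => [|i _].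
  by rewrite expr0 /central_binom big_ord0 addr0; ring.
by rewrite expr1n subrr expr0n/= mulr0.
Qed.

Let der_coef m : 0 < (m%:R + 2^-1) * central_binom m.
Proof.
rewrite mulr_gt0 ?central_binom_gt0//; have := ler0n R m; lra.
Qed.

Lemma walk_defect_le m x y : 0 <= x -> x <= y -> y <= 1 ->
  walk_defect m x <= walk_defect m y.
Proof.
move=> x0 xy y1; apply: (der_ge0_le xy (fun z _ => walk_defect_der m z)).
move=> z /andP[xz zy]; rewrite mulr_ge0 ?(ltW (der_coef m))// exprn_ge0//.
by rewrite subr_ge0 expr_le1//; lra.
Qed.

Lemma walk_defect_ge0 m x : 0 <= x <= 1 -> 0 <= walk_defect m x.
Proof. by move=> /andP[? ?]; rewrite -(walk_defect0 m) walk_defect_le. Qed.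

Lemma walk_defect_le_half m x : 0 <= x <= 1 -> walk_defect m x <= 2^-1.
Proof. by move=> /andP[? ?]; rewrite -(walk_defect1 m) walk_defect_le. Qed.

Let expR_onem_anti u v : 0 <= u -> u <= v -> v <= 1 ->
  (1 - v) * expR v <= (1 - u) * expR u.
Proof.
move=> u0 uv v1; have -> : u = v + (u - v) by ring.
rewrite expRD mulrCA [leLHS]mulrC ler_pM2l ?expR_gt0//.
have := expR_ge1Dx (u - v); nra.
Qed.

(* Both [walk_defect m] and the rescaled Gaussian primitive increase from 0 to
   at most 1/2, and the ratio of their derivatives is monotone. *)
Lemma herf_le_walk_defect m x : 0 <= x <= 1 ->
  herf (x * Num.sqrt m%:R) <= walk_defect m x.
Proof.
move=> x01; set s := Num.sqrt _.
have s0 : 0 <= s by exact: sqrtr_ge0.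
have s2 : s ^+ 2 = m%:R by rewrite sqr_sqrtr ?ler0n.
rewrite -subr_ge0 leNgt; apply/negP.
set f := fun x => walk_defect m x - herf (x * s).
pose a := (m%:R + 2^-1) * central_binom m.
have fd z : has_derive z f (a * (1 - z ^+ 2) ^+ m - s * gauss (z * s)).
  apply: der_eq.
    apply: der_add; first exact: walk_defect_der.
    apply: der_opp; apply: (der_comp (f := herf)); first exact: herf_der.
    by apply: der_mul; [exact: der_id | exact: der_cst].
  by rewrite /a; ring.
(* Since s^2 = m, dividing by the Gaussian leaves an m-th power of (1 - z^2) exp(z^2), which
   decreases on [0, 1]; hence the sign of the derivative changes at most once. *)
have dE z : a * (1 - z ^+ 2) ^+ m - s * gauss (z * s) =
    expR (- (z * s) ^+ 2) *
    (a * ((1 - z ^+ 2) * expR (z ^+ 2)) ^+ m - s / Num.sqrt pi).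
  rewrite [(_ * expR _) ^+ m]exprMn -expRM_natl -s2.
  have := expRxMexpNx_1 ((z * s) ^+ 2); rewrite /gauss.
  set e1 := expR _; set e2 := expR _ => e12.
  have -> : s ^+ 2 * z ^+ 2 = (z * s) ^+ 2 by ring.
  rewrite -/e1 mulrBr.
  have -> : e2 * (a * ((1 - z ^+ 2) ^+ m * e1)) =
    a * (1 - z ^+ 2) ^+ m * (e1 * e2) by ring.
  by rewrite e12 -/e2; ring.
have sgn c d : 0 <= c -> c <= d -> d <= 1 ->
    a * (1 - c ^+ 2) ^+ m - s * gauss (c * s) < 0 ->
    a * (1 - d ^+ 2) ^+ m - s * gauss (d * s) <= 0.
  move=> c0 cd d1; rewrite !dE.
  rewrite pmulr_rlt0 ?expR_gt0// pmulr_rle0 ?expR_gt0// => rc.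
  apply: ltW; apply: le_lt_trans rc; rewrite lerD2r ler_pM2l ?der_coef//.
  have d0 : 0 <= d by rewrite (le_trans c0).
  apply: lerXn2r; rewrite ?nnegrE.
  - by rewrite mulr_ge0 ?expR_ge0// subr_ge0 expr_le1.
  - by rewrite mulr_ge0 ?expR_ge0// subr_ge0 expr_le1// (le_trans cd).
  - apply: expR_onem_anti; [exact: sqr_ge0| |by rewrite expr_le1].
    by rewrite ler_pXn2r ?nnegrE.
have f0 : 0 <= f 0 by rewrite /f walk_defect0 mul0r herf0 subr0.
(* The contradiction comes from the end point 1, where [walk_defect] equals 1/2 and [herf] is at
   most 1/2. *)
move=> fx0; have := unimodal_ge0 (fun z _ => fd z) sgn f0 x01 fx0.
rewrite leNgt => /negP; apply; apply: (lt_le_trans fx0).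
by rewrite /f walk_defect1 subr_ge0 herf_le_half.
Qed.

End DefectLower.

(** * Upper bound of the defect by the Gaussian primitive *)

Section DefectUpper.
Context {R : realType}.
Implicit Types (x y z t u v s : R) (m n : nat).

Let expRN_1D_anti u v : 0 <= u -> u <= v ->
  (1 + v) * expR (- v) <= (1 + u) * expR (- u).
Proof.
move=> u0 uv; have -> : - u = - v + (v - u) by ring.
rewrite expRD mulrCA [leLHS]mulrC ler_pM2l ?expR_gt0//.
have := expR_ge1Dx (v - u); nra.
Qed.

(* [t / sqrt (1 + t ^ 2)] inverts [x / sqrt (1 - x ^ 2)]. *)
Let q t : R := t / Num.sqrt (1 + t ^+ 2).

Let S_gt0 t : 0 < Num.sqrt (1 + t ^+ 2).
Proof. by rewrite sqrtr_gt0; have := sqr_ge0 t; lra. Qed.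

Let S_sqr t : Num.sqrt (1 + t ^+ 2) ^+ 2 = 1 + t ^+ 2.
Proof. by rewrite sqr_sqrtr//; have := sqr_ge0 t; lra. Qed.

Let q01 t : 0 <= t -> 0 <= q t <= 1.
Proof.
move=> t0; rewrite divr_ge0 ?(ltW (S_gt0 t))//= ler_pdivrMr ?mul1r//.
rewrite -[leLHS](ger0_norm t0) -sqrtr_sqr ler_sqrt; have := sqr_ge0 t; lra.
Qed.

Let q_der t : has_derive t q (Num.sqrt (1 + t ^+ 2) ^- 3).
Proof.
have S0 := S_gt0 t.
have S2 := S_sqr t.
rewrite /q; apply: der_eq.
  apply: der_mul; first exact: der_id.
  apply: der_inv; first exact: lt0r_neq0.
  apply: der_sqrt; last by der.
  by have := sqr_ge0 t; lra.
rewrite /=; move: S0 S2; set S : R := Num.sqrt _ => S0 S2.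
have S'0 : S != 0 by exact: lt0r_neq0.
apply: (mulIf (expf_neq0 3 S'0)); rewrite mulVf ?expf_neq0//.
transitivity (S ^+ 2 - t ^+ 2); last by rewrite S2; ring.
by field.
Qed.

Let q_onem t : 1 - q t ^+ 2 = (1 + t ^+ 2)^-1.
Proof.
rewrite /q expr_div_n S_sqr; have t0 : 1 + t ^+ 2 != 0.
  by apply: lt0r_neq0; have := sqr_ge0 t; lra.
by field.
Qed.

(** Under x = q t the derivative of the defect becomes a (1 + t^2)^(- m - 3/2). With s^2 = m + 2,
    the ratio of the Gaussian derivative to it is, up to a constant, ((1 + t^2) exp(- t^2))^(m + 2)
    / sqrt(1 + t^2), which decreases. *)
Let walk_defect_q_le m t : 0 <= t ->
  walk_defect m (q t) <= herf (t * Num.sqrt m.+2%:R).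
Proof.
move=> t0; set s : R := Num.sqrt _.
have s0 : 0 < s by rewrite sqrtr_gt0 ltr0n.
have s2 : s ^+ 2 = m.+2%:R by rewrite sqr_sqrtr ?ler0n.
rewrite -subr_ge0 leNgt; apply/negP.
set f := fun t => herf (t * s) - walk_defect m (q t).
pose a := (m%:R + 2^-1) * central_binom m : R.
have a0 : 0 < a.
  by rewrite mulr_gt0 ?central_binom_gt0//; have := ler0n R m; lra.
pose d t := s * gauss (t * s) -
  a * (1 + t ^+ 2) ^- m * Num.sqrt (1 + t ^+ 2) ^- 3.
have fd z : has_derive z f (d z).
  apply: der_eq.
    apply: der_add.
      apply: (der_comp (f := herf)); first exact: herf_der.
      by apply: der_mul; [exact: der_id | exact: der_cst].
    apply: der_opp; apply: (der_comp (f := walk_defect m)).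
      exact: walk_defect_der.
    exact: q_der.
  by rewrite /d q_onem exprVn /a; ring.
have dE z : d z = (s / Num.sqrt pi *
    (((1 + z ^+ 2) * expR (- z ^+ 2)) ^+ m.+2 / Num.sqrt (1 + z ^+ 2)) - a)
    * ((1 + z ^+ 2) ^- m * Num.sqrt (1 + z ^+ 2) ^- 3).
  have S0 := lt0r_neq0 (S_gt0 z).
  have p0 := lt0r_neq0 (@sqrt_pi_gt0 R).
  have u0 : 1 + z ^+ 2 != 0 by rewrite -S_sqr expf_neq0.
  rewrite /d /gauss [(_ * expR _) ^+ _]exprMn -expRM_natl -s2.
  have -> : s ^+ 2 * - z ^+ 2 = - (z * s) ^+ 2 by ring.
  set e : R := expR _.
  move: u0 S0 (S_sqr z); set S : R := Num.sqrt (1 + _); set u : R := 1 + _.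
  set P : R := Num.sqrt pi in p0 *; clearbody S e P.
  move=> u0 S0 uS; rewrite mulrBl mulrA; congr (_ - _).
    have S1 : (S ^+ 2) ^+ 2 / S * S ^- 3 = 1 by field.
    transitivity (s / P * e * ((S ^+ 2) ^+ 2 / S * S ^- 3)).
      by rewrite S1 mulr1 mulrAC.
    rewrite uS -[m.+2]addn2 exprD.
    have {1}-> : u ^+ 2 = u ^+ m * u ^+ 2 * u ^- m.
      by rewrite mulrAC divff ?mul1r// expf_neq0.
    ring.
  ring.
have w0 z : 0 < (1 + z ^+ 2) ^- m * Num.sqrt (1 + z ^+ 2) ^- 3.
  rewrite mulr_gt0// invr_gt0 exprn_gt0//.
  by have := sqr_ge0 z; lra.
(* Stated for every right end b: [unimodal_ge0] works on a bounded interval, while t ranges over a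
   half-line. *)
have sgn b c e : 0 <= c -> c <= e -> e <= b -> d c < 0 -> d e <= 0.
  move=> c0 ce _; rewrite !dE pmulr_llt0// pmulr_lle0// => rc.
  apply: ltW; apply: le_lt_trans rc; rewrite lerD2r ler_pM2l; last first.
    by rewrite divr_gt0// sqrt_pi_gt0.
  have e0 : 0 <= e by rewrite (le_trans c0).
  have ce2 : c ^+ 2 <= e ^+ 2 by rewrite ler_pXn2r ?nnegrE.
  have D z : 0 <= (1 + z ^+ 2) * expR (- z ^+ 2).
    by rewrite mulr_ge0 ?expR_ge0//; have := sqr_ge0 z; lra.
  apply: ler_pM; rewrite ?exprn_ge0 ?invr_ge0 ?(ltW (S_gt0 _))//.
    apply: lerXn2r; rewrite ?nnegrE//.
    by apply: expRN_1D_anti; rewrite ?sqr_ge0.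
  by rewrite lef_pV2 ?posrE// ler_sqrt; have := sqr_ge0 e; lra.
have f0 : 0 <= f 0 by rewrite /f /q !mul0r walk_defect0 herf0 subr0.
move=> ft0.
have fb b : t <= b -> f b <= f t.
  move=> tb; apply: (unimodal_ge0 (fun z _ => fd z) (sgn b) f0) => //.
  by rewrite t0.
(* Beyond t the function f stays below f t < 0, yet [herf] tends to 1/2 and the defect never exceeds
   1/2. *)
have : herf z @[z --> +oo] --> (2^-1 : R) := herf_cvg.
have fE : 2^-1 + f t < 2^-1 by rewrite gtrDl.
move=> /cvgr_gt /(_ _ fE) near_half.
near +oo_R => z.
have zt : t * s <= z by near: z; apply: nbhs_pinfty_ge; exact: num_real.
have hz : 2^-1 + f t < herf z by near: z.
have tzs : t <= z / s by rewrite ler_pdivlMr.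
have := fb _ tzs; rewrite {1}/f divfK ?lt0r_neq0//.
have := walk_defect_le_half m (q01 (le_trans t0 tzs)); lra.
Unshelve. all: by end_near.
Qed.

Lemma walk_defect_le_herf m x : 0 <= x < 1 ->
  walk_defect m x <= herf (x / Num.sqrt (1 - x ^+ 2) * Num.sqrt m.+2%:R).
Proof.
move=> /andP[x0 x1].
have k0 : 0 < 1 - x ^+ 2 by rewrite subr_gt0 expr_lt1.
set k := Num.sqrt (1 - x ^+ 2).
have k1 : 0 < k by rewrite sqrtr_gt0.
have k2 : k ^+ 2 = 1 - x ^+ 2 by rewrite sqr_sqrtr// ltW.
have y0 : 0 <= x / k by rewrite divr_ge0// ltW.
have := walk_defect_q_le m y0; rewrite /q.
have k'0 : k != 0 by exact: lt0r_neq0.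
have -> : 1 + (x / k) ^+ 2 = k^-1 ^+ 2.
  transitivity ((k ^+ 2 + x ^+ 2) / k ^+ 2); first by field.
  have -> : k ^+ 2 + x ^+ 2 = 1 by rewrite k2 subrK.
  by field.
by rewrite sqrtr_sqr gtr0_norm ?invr_gt0// invrK divfK.
Qed.

End DefectUpper.

(** * The discrete value *)

Section Walk.
Context {R : realType}.
Context (eps : R).
Implicit Types (phi : int -> R) (y s : int) (m n k : nat).

Local Notation p := ((1 + eps) / 2).
Local Notation q := ((1 - eps) / 2).

Fixpoint walkE k phi y : R :=
  if k is k'.+1 then p * walkE k' phi (y + 1) + q * walkE k' phi (y - 1)
  else phi y.

Definition risky_prob y : R := if y < 0 then 1 else if y == 0 then 2^-1 else 0.

Lemma arm_prob_myopic y n :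
  arm_prob (myopic eps (y%:~R + eps * n%:R) (- n%:R)) true = risky_prob y /\
  arm_prob (myopic eps (y%:~R + eps * n%:R) (- n%:R)) false = 1 - risky_prob y.
Proof.
rewrite /myopic mulrN addrK ltr0z intr_eq0 /risky_prob.
case: (ltgtP y 0) => _ /=; rewrite ?subrr ?subr0; split=> //.
by field.
Qed.

(** The law of - g2 is that of g1, so the position follows the same walk under both arms and only
    the expected number of risky pulls is left to count. *)
Lemma vbar_walk n y s : vbar eps n (y%:~R + eps * n%:R) s =
  2 * eps * s%:~R + 2 * eps * \sum_(k < n) walkE k risky_prob y.
Proof.
elim: n y s => [|n IH] y s; first by rewrite [LHS]/= big_ord0 mulr0 addr0.
(* The - eps in [dxi] is absorbed by the decrease of n, so the lattice point moves by exactly g. *)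
have H (g : R) z t : g = z%:~R ->
    vbar eps n (y%:~R + eps * n.+1%:R + (g - eps)) t =
    2 * eps * t%:~R + 2 * eps * \sum_(k < n) walkE k risky_prob (y + z).
  move=> ->; rewrite -IH; congr (vbar _ _ _ _).
  by rewrite intrD -natr1; ring.
have [a2 a1] := arm_prob_myopic y n.+1.
rewrite (_ : vbar _ _ _ _ = \sum_(g1 : bool) \sum_(g2 : bool) \sum_(I : bool)
  bernoulli_pmf p g1 * bernoulli_pmf q g2 *
  arm_prob (myopic eps (y%:~R + eps * n.+1%:R) (- n.+1%:R)) I *
  vbar eps n (y%:~R + eps * n.+1%:R + dxi eps g1 g2 I) (s + I%:Z))//.
rewrite !big_bool a1 a2 /dxi /bernoulli_pmf /= /reward.
rewrite !mulr1n !mulr0n !subr0 !sub0r !opprK.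
rewrite !(H 1 1)// !(H (-1) (-1))// !intrD.
rewrite big_ord_recl /= big_split /= -!mulr_sumr.
set A := \sum_(i < n) walkE i _ (y + 1).
set B := \sum_(i < n) walkE i _ (y - 1).
rewrite -[1%Z%:~R]/(1 : R); by field.
Qed.

(** Splits off the last step instead of the first, so that increments in k become expectations of
    [drift]. *)
Lemma walkES k phi y :
  walkE k.+1 phi y = walkE k (fun z => p * phi (z + 1) + q * phi (z - 1)) y.
Proof. by elim: k y => [//|k IH] y; rewrite /= -!IH. Qed.

Lemma walkE_binomial k phi y : walkE k phi y =
  \sum_(j < k.+1)
    'C(k, j)%:R * p ^+ j * q ^+ (k - j) * phi (y + j.*2%:Z - k%:Z).
Proof.
elim: k phi y => [|k IH] phi y.
  by rewrite big_ord1 /= bin0 !expr0 !mulr1 mul1r addr0 subr0.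
rewrite /= !IH [RHS]big_ord_recl /=.
under [in RHS]eq_bigr => i _.
  rewrite /= ?lift0 ?add1n binS natrD.
  rewrite 3!mulrDl.
  over.
rewrite big_split /= addrA addrC; congr (_ + _).
  rewrite mulr_sumr; apply: eq_bigr => i _.
  rewrite subSS exprS doubleS.
  have -> : y + (i.*2.+2)%:Z - k.+1%:Z = y + 1 + (i.*2)%:Z - k%:Z by lia.
  ring.
transitivity (\sum_(j < k.+2) 'C(k, j)%:R * p ^+ j * q ^+ (k.+1 - j)
    * phi (y + j.*2%:Z - k.+1%:Z)); last by rewrite big_ord_recl /= !bin0.
rewrite [RHS]big_ord_recr /= bin_small// !mul0r addr0.
rewrite mulr_sumr; apply: eq_bigr => i _.
rewrite subSn -1?ltnS// exprS.
have -> : y - 1 + (i.*2)%:Z - k%:Z = y + (i.*2)%:Z - k.+1%:Z by lia.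
ring.
Qed.

Lemma central_binomE m : 'C(m.*2, m)%:R = central_binom m * 4 ^+ m :> R.
Proof.
elim: m => [|m IH]; first by rewrite bin0 /central_binom big_ord0 mulr1.
have e1 := congr1 (fun n => n%:R : R) (mul_bin_diag m.*2.+2 m).
have e2 := congr1 (fun n => n%:R : R) (mul_bin_down m.*2.+1 m).
have e3 := @central_binomS R m.
move: e1 e2; rewrite /= !natrM IH (_ : (m.*2.+1 - m = m.+1)%N); last by lia.
rewrite doubleS exprS; set a := 'C(_.+2, _)%:R; set b := 'C(_.+1, _)%:R.
have -> : m.*2.+2%:R = 2 * (m%:R + 1) :> R.
  by rewrite -doubleS -mul2n natrM -[m.+1%:R]natr1.
have -> : m.*2.+1%:R = 2 * m%:R + 1 :> R.
  by rewrite -[m.*2.+1%:R]natr1 -mul2n natrM.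
rewrite -[m.+1%:R]natr1 => e1 e2.
have m1 : m%:R + 1 != 0 :> R by apply: lt0r_neq0; have := ler0n R m; lra.
have {e1} <- : 2 * b = a.
  by apply: (mulfI m1); rewrite -e1; ring.
apply: (mulfI m1); rewrite mulrCA -e2 mulrA -e3; ring.
Qed.

(* At odd times the contributions of [z = -1] and [z = 1] cancel. *)
Let drift z := p * risky_prob (z + 1) + q * risky_prob (z - 1) - risky_prob z.

(** [risky_prob] is constant on each side of 0, so only positions within one step of 0
    contribute. *)
Let driftE z : drift z =
  if z == 0 then - eps / 2 else if z == 1 then q / 2
  else if z == -1 then - p / 2 else 0.
Proof.
rewrite /drift /risky_prob.
have [->|z0] := eqVneq z 0; first by rewrite /=; field.
have [->|z1] := eqVneq z 1; first by rewrite /=; field.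
have [->|z2] := eqVneq z (-1); first by rewrite /=; field.
have [zn|zp] := ltP z 0.
  have -> : z + 1 < 0 by lia.
  have -> : z - 1 < 0 by lia.
  by field.
have -> : (z + 1 < 0) = false by lia.
have -> : (z - 1 < 0) = false by lia.
have -> : (z + 1 == 0) = false by lia.
have -> : (z - 1 == 0) = false by lia.
by rewrite !mulr0 addr0 subr0.
Qed.

Let walkE_drift k : walkE k.+1 risky_prob 0 - walkE k risky_prob 0 =
  \sum_(j < k.+1) 'C(k, j)%:R * p ^+ j * q ^+ (k - j) * drift (j.*2%:Z - k%:Z).
Proof.
rewrite walkES !walkE_binomial -sumrB; apply: eq_bigr => j _.
by rewrite -mulrBr !add0r.
Qed.

Let walkE_drift_odd m : walkE m.*2.+2 risky_prob 0 = walkE m.*2.+1 risky_prob 0.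
Proof.
apply/eqP; rewrite -subr_eq0 walkE_drift; apply/eqP.
have m1 : (m < m.*2.+2)%N by lia.
have m2 : (m.+1 < m.*2.+2)%N by lia.
(* At time 2 m + 1 the indices j = m and j = m + 1 are the positions -1 and 1; all others lie off
   the support of [drift]. *)
rewrite (bigD1 (Ordinal m1))// (bigD1 (Ordinal m2))/=; last first.
  by rewrite -val_eqE/=; lia.
rewrite big1 ?addr0 => [|j /andP[j1 j2]]; last first.
  move: j1 j2; rewrite -!val_eqE/= => j1 j2; rewrite driftE.
  have -> : (j.*2%:Z - m.*2.+1%:Z == 0) = false by lia.
  have -> : (j.*2%:Z - m.*2.+1%:Z == 1) = false by lia.
  have -> : (j.*2%:Z - m.*2.+1%:Z == -1) = false by lia.
  by rewrite mulr0.
rewrite !driftE.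
have -> : (m.*2%:Z - m.*2.+1%:Z == 0) = false by lia.
have -> : (m.*2%:Z - m.*2.+1%:Z == 1) = false by lia.
have -> : (m.*2%:Z - m.*2.+1%:Z == -1) by lia.
have -> : (m.+1.*2%:Z - m.*2.+1%:Z == 0) = false by lia.
have -> : (m.+1.*2%:Z - m.*2.+1%:Z == 1) by lia.
have -> : 'C(m.*2.+1, m.+1) = 'C(m.*2.+1, m).
  by rewrite -bin_sub; [congr 'C(_, _); lia | lia].
have -> : (m.*2.+1 - m = m.+1)%N by lia.
have -> : (m.*2.+1 - m.+1 = m)%N by lia.
rewrite !exprS; ring.
Qed.

(** At even times only a visit to 0 contributes; its probability is ['C(2 m, m)] (p q)^m, and 4 p q
    = 1 - eps^2. *)
Let walkE_drift_even m : walkE m.*2.+1 risky_prob 0 =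
  walkE m.*2 risky_prob 0 - eps / 2 * (central_binom m * (1 - eps ^+ 2) ^+ m).
Proof.
rewrite -[LHS](subrK (walkE m.*2 risky_prob 0)) walkE_drift addrC.
congr (_ + _).
have m1 : (m < m.*2.+1)%N by lia.
rewrite (bigD1 (Ordinal m1))//= big1 ?addr0 => [|j]; last first.
  rewrite -val_eqE/= => j1; rewrite driftE.
  have -> : (j.*2%:Z - m.*2%:Z == 0) = false by lia.
  have -> : (j.*2%:Z - m.*2%:Z == 1) = false by lia.
  have -> : (j.*2%:Z - m.*2%:Z == -1) = false by lia.
  by rewrite mulr0.
rewrite driftE subrr eqxx central_binomE (_ : (m.*2 - m = m)%N); last by lia.
have -> : (1 - eps ^+ 2) ^+ m = 4 ^+ m * p ^+ m * q ^+ m.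
  by rewrite -!exprMn; congr (_ ^+ m); field.
ring.
Qed.

(** The halving pairs the times 2 m + 1 and 2 m + 2; the value at 0 is 0 because the walk starts at
    0, where the arms are equally likely. *)
Definition defect k : R := if k is k'.+1 then walk_defect k'./2 eps else 0.

Lemma walkE_risky_prob k : walkE k risky_prob 0 = 2^-1 - defect k.
Proof.
suff H m : walkE m.*2.+1 risky_prob 0 = 2^-1 - walk_defect m eps.
  case: k => [|k]; first by rewrite /= subr0.
  have [ko|ke] := boolP (odd k).
    have kE : k = k./2.*2.+1 by have := odd_double_half k; rewrite ko; lia.
    by rewrite {1}kE walkE_drift_odd H /defect.
  have kE : k = k./2.*2 by have := odd_double_half k; rewrite (negbTE ke); lia.
  by rewrite {1}kE H /defect.
elim: m => [|m IH].
  by rewrite walkE_drift_even /walk_defect big_ord1 !expr0.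
rewrite walkE_drift_even doubleS walkE_drift_odd IH.
by rewrite walk_defectS; ring.
Qed.

Lemma vbar_defect T : vbar eps T (eps * T%:R) 0 =
  \sum_(k < T) (eps * (1 - 2 * defect k)).
Proof.
have := vbar_walk T 0 0; rewrite add0r => ->.
rewrite mulr0 add0r mulr_sumr; apply: eq_bigr => k _.
by rewrite walkE_risky_prob; field.
Qed.

End Walk.

(** * The continuous value *)

Section ContinuousValue.
Context {R : realType}.
Implicit Types (x y z t s b c L : R).
Local Notation mu := (@lebesgue_measure R).

Let affine_cvgy L c : 0 < L -> (s + c) / L @[s --> +oo] --> +oo.
Proof.
move=> L0; apply/cvgryPge => A; near=> s.
rewrite ler_pdivlMr// -lerBlDr; near: s.
by apply: nbhs_pinfty_ge; exact: num_real.
Unshelve. all: by end_near.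
Qed.

Let herf_affine_der L c s : has_derive s (fun s => herf ((s + c) / L))
  (gauss ((s + c) / L) / L).
Proof.
apply: der_eq.
  by apply: (der_comp (f := herf)); [exact: herf_der | der].
by rewrite /=; ring.
Qed.

Let gauss_affine_der L c s : has_derive s (fun s => gauss ((s + c) / L))
  (- 2 * ((s + c) / L) * gauss ((s + c) / L) / L).
Proof.
apply: der_eq.
  by apply: (der_comp (f := gauss)); [exact: der_gauss | der].
by rewrite /=; ring.
Qed.

Let moment_continuous a L c :
  continuous (fun s => a * s * (gauss ((s + c) / L) / L)).
Proof.
move=> s; apply: cvgM; first by apply: cvgMr; exact: cvg_id.
apply: cvgMl; exact: der_continuous (gauss_affine_der L c s).
Qed.

Let gauss_gap_continuous b L c : continuous
  (fun s => b * (gauss ((s + c) / L) / L - gauss ((s - c) / L) / L)).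
Proof.
move=> s; apply: cvgMr; apply: cvgB; apply: cvgMl.
  exact: der_continuous (gauss_affine_der L c s).
exact: der_continuous (gauss_affine_der L (- c) s).
Qed.

Let herf_affine_cvg L c : 0 < L ->
  herf ((s + c) / L) @[s --> +oo] --> (2^-1 : R).
Proof. by move=> L0; apply: cvg_comp (affine_cvgy c L0) herf_cvg. Qed.

Let gauss_affine_cvg L c : 0 < L ->
  gauss ((s + c) / L) @[s --> +oo] --> (0 : R).
Proof.
move=> L0; rewrite -(mul0r (Num.sqrt pi)^-1); apply: cvgMl.
by apply: cvg_comp (affine_cvgy c L0) (@cvg_gauss_fun R).
Qed.

Let integral_linear L c : 0 < L -> 0 <= c ->
  (\int[mu]_(s in `[0%R, +oo[) (2 * s * (gauss ((s + c) / L) / L))%:E =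
  (L * gauss (c / L) + 2 * c * herf (c / L) - c)%:E)%E.
Proof.
move=> L0 c0.
(* The [gauss] term differentiates to the moment 2 (s + c); the [herf] term removes the shift 2
   c. *)
pose F s : R := - L * gauss ((s + c) / L) - 2 * c * herf ((s + c) / L).
have dF s : has_derive s F (2 * s * (gauss ((s + c) / L) / L)).
  rewrite /F; apply: der_eq.
    apply: der_add.
      by apply: der_mul; [exact: der_cst | exact: gauss_affine_der].
    apply: der_opp; apply: der_mul; first exact: der_cst.
    exact: herf_affine_der.
  by rewrite /=; field; exact: lt0r_neq0.
rewrite (@ge0_continuous_FTC2y _ _ F 0 (- c)).
- by rewrite -EFinB /F add0r; congr (_%:E); ring.
- move=> s s0; rewrite mulr_ge0 ?divr_ge0 ?(ltW L0) ?(ltW (gauss_gt0 _))//.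
  by rewrite mulr_ge0.
- by apply: continuous_subspaceT; exact: moment_continuous.
- have -> : - c = - L * 0 - 2 * c * 2^-1 by field.
  apply: cvgB; apply: cvgMr; first exact: gauss_affine_cvg.
  exact: herf_affine_cvg.
- by move=> s _; case: (dF s).
- by apply: cvg_at_right_filter; exact: der_continuous (dF 0).
- by move=> s _; rewrite derive1E; case: (dF s).
Qed.

Let integral_exp L b c : 0 < L -> 0 <= b -> 0 <= c ->
  (\int[mu]_(s in `[0%R, +oo[)
    (b * (gauss ((s + c) / L) / L - gauss ((s - c) / L) / L))%:E =
  (- (2 * b * herf (c / L)))%:E)%E.
Proof.
move=> L0 b0 c0.
pose F s : R := b * (herf ((s + c) / L) - herf ((s - c) / L)).
have dF s : has_derive s F
    (b * (gauss ((s + c) / L) / L - gauss ((s - c) / L) / L)).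
  rewrite /F; apply: der_eq.
    apply: der_mul; first exact: der_cst.
    apply: der_add; first exact: herf_affine_der.
    apply: der_opp; exact: (herf_affine_der L (- c)).
  by rewrite /=; ring.
rewrite (@le0_continuous_FTC2y _ _ F 0 0).
- rewrite -EFinB /F add0r sub0r mulNr herf_odd add0r.
  by congr (_%:E); ring.
(* For s, c >= 0 the point s is no farther from c than from - c, so the integrand has constant
   sign. *)
- move=> s s0; rewrite mulr_ge0_le0// subr_le0.
  rewrite ler_pM2r ?invr_gt0// ler_pM2r ?invr_gt0 ?sqrt_pi_gt0//.
  rewrite ler_expR lerN2 !expr_div_n ler_pM2r ?invr_gt0 ?exprn_gt0//.
  nra.
- by apply: continuous_subspaceT; exact: gauss_gap_continuous.
- have -> : (0 : R) = b * (2^-1 - 2^-1) by rewrite subrr mulr0.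
  by apply: cvgMr; apply: cvgB; exact: herf_affine_cvg.
- by apply: cvg_at_right_filter; exact: der_continuous (dF 0).
- by move=> s _; case: (dF s).
- by move=> s _; rewrite derive1E; case: (dF s).
Qed.

(** Here f stands for the integrand of [ubar], split at the kink of [phibar]; the reflection of s
    turns the left half into [integral_linear], and the right half is [integral_exp]. *)
Lemma integral_two_sided L b c (f : R -> R) : 0 < L -> 0 <= b -> 0 <= c ->
  (forall s, s <= 0 -> f s = - 2 * s * (gauss ((s - c) / L) / L)) ->
  (forall s, 0 < s ->
    f s = b * (gauss ((s + c) / L) / L - gauss ((s - c) / L) / L)) ->
  \int[mu]_s f s =
  L * gauss (c / L) + 2 * c * herf (c / L) - c - 2 * b * herf (c / L).
Proof.
move=> L0 b0 c0 fn fp.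
pose fm s : R := - 2 * s * (gauss ((s - c) / L) / L).
pose fq s : R := b * (gauss ((s + c) / L) / L - gauss ((s - c) / L) / L).
have cm : continuous fm by exact: (@moment_continuous (- 2) L (- c)).

have cq : continuous fq by exact: gauss_gap_continuous.
have mm (D : set R) : measurable_fun D fm.
  by apply: measurable_funTS; exact: continuous_measurable_fun.
have mq (D : set R) : measurable_fun D fq.
  by apply: measurable_funTS; exact: continuous_measurable_fun.
have mfn : measurable_fun (`]-oo, 0%R] : set R) f.
  apply: (eq_measurable_fun fm) (mm _) => s.
  by rewrite inE/= in_itv/= => s0; rewrite fn.
have mfp : measurable_fun (`]0%R, +oo[ : set R) f.
  apply: (eq_measurable_fun fq) (mq _) => s.
  by rewrite inE/= in_itv/= andbT => s0; rewrite fp.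
have TE : [set: R] = `]-oo, 0%R] `|` `]0%R, +oo[.
  apply/esym/seteqP; split=> // s _ /=; rewrite !in_itv/= andbT.
  by apply/orP; rewrite leNgt orNb.
have mT : measurable_fun [set: R] f.
  by rewrite TE; apply/measurable_funU.
rewrite /Rintegral TE integral_setU//=; last 2 first.
- by rewrite -TE; exact: measurableT_comp.
- apply/disj_setPS => s [] /=; rewrite !in_itv/= andbT => s0.
  by rewrite ltNge s0.
have -> : (\int[mu]_(s in `]-oo, 0%R]) (f s)%:E =
    (L * gauss (c / L) + 2 * c * herf (c / L) - c)%:E)%E.
  rewrite -integral_linear//.
  transitivity (\int[mu]_(s in `]-oo, (- 0)%R]) (fm s)%:E)%E.
    rewrite oppr0; apply: eq_integral => s.
    by rewrite inE/= in_itv/= => s0; rewrite fn.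
  rewrite ge0_integration_by_substitutionNy.
  - apply: eq_integral => s _; rewrite /fm /=.
    have -> : (- s - c) / L = - ((s + c) / L) by ring.
    by rewrite gauss_even; congr (_%:E); ring.
  - exact: continuous_subspaceT.
  - move=> s; rewrite in_itv/= oppr0 => s0.
    rewrite /fm mulr_ge0 ?divr_ge0 ?(ltW L0) ?(ltW (gauss_gt0 _))//.
    by nra.
have -> : (\int[mu]_(s in `]0%R, +oo[) (f s)%:E =
    (- (2 * b * herf (c / L)))%:E)%E.
  rewrite -integral_exp// -integral_itv_obnd_cbnd.
    by apply: eq_integral => s; rewrite inE/= in_itv/= andbT => /fp ->.
  by apply: measurableT_comp.
by rewrite -EFinD.
Qed.

End ContinuousValue.

(** * The rescaled continuous value and its increments *)

Section Profile.
Context {R : realType}.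
Implicit Types (x y z : R).

(* In the scaled time [z = eps * sqrt (T / (2 kappa))], the continuous value at
   the start is [2 kappa / eps * profile z]. *)
Definition profile z : R := z ^+ 2 - z * gauss z + (1 - 2 * z ^+ 2) * herf z.

Lemma profile0 : profile 0 = 0.
Proof. by rewrite /profile herf0 expr0n mulr0 mul0r subr0 addr0. Qed.

Let profile_der z : has_derive z profile (2 * z * (1 - 2 * herf z)).
Proof.
rewrite /profile; apply: der_eq.
  apply: der_add; first apply: der_add.
  - by der.
  - apply: der_opp; apply: der_mul; first exact: der_id.
    exact: der_gauss.
  - apply: der_mul; first by der.
    exact: herf_der.
by rewrite /=; ring.
Qed.

(** As a function of z^2, [profile] has slope 1 - 2 [herf z], which decreases, so the slopes at the
    two ends bound the mean slope. *)
Lemma profile_increment x y : 0 <= x -> x <= y ->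
  (1 - 2 * herf y) * (y ^+ 2 - x ^+ 2) <= profile y - profile x
    <= (1 - 2 * herf x) * (y ^+ 2 - x ^+ 2).
Proof.
move=> x0 xy; apply/andP; split.
  pose f z := profile z - (1 - 2 * herf y) * z ^+ 2.
  have fd z : has_derive z f
      (2 * z * (1 - 2 * herf z) - (1 - 2 * herf y) * (2 * z)).
    rewrite /f; apply: der_eq.
      apply: der_add; first exact: profile_der.
      by apply: der_opp; der.
    by rewrite /=; ring.
  have : f x <= f y.
    apply: (der_ge0_le xy (fun z _ => fd z)) => z /andP[xz zy].
    by have := herf_le zy; nra.
  by rewrite /f; lra.
pose f z := (1 - 2 * herf x) * z ^+ 2 - profile z.
have fd z : has_derive z f
    ((1 - 2 * herf x) * (2 * z) - 2 * z * (1 - 2 * herf z)).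
  rewrite /f; apply: der_eq.
    apply: der_add; first by der.
    by apply: der_opp; exact: profile_der.
  by rewrite /=; ring.
have : f x <= f y.
  apply: (der_ge0_le xy (fun z _ => fd z)) => z /andP[xz zy].
  by have := herf_le xz; nra.
by rewrite /f; lra.
Qed.

End Profile.

(** * Telescoping sums with shifted indices *)

Section Telescope.
Context {R : realType}.
Implicit Types (d g : nat -> R) (c e a x y : R).

(** A shift by three leaves three terms at each end; those at the start are dropped by
    nonnegativity. *)
Lemma sum_le_shift_up d g e n : 0 <= e -> (forall k, 0 <= g k) ->
  (forall k, d k <= e * (g k.+3 - g k)) ->
  \sum_(k < n) d k <= e * (g n.+1 + g n.+2 + g n).
Proof.
move=> e0 g0 dg.
have h : \sum_(k < n) d k <= e * (g n.+1 + g n.+2 + g n - (g 0 + g 1 + g 2)).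
  elim: n => [|n IH]; first by rewrite big_ord0; lra.
  by rewrite big_ord_recr /=; have := dg n; lra.
apply: (le_trans h); rewrite ler_wpM2l// gerBl.
by rewrite !addr_ge0.
Qed.

(** The subtraction k - 2 truncates at 0, and [g 0 = 0] makes the truncated initial terms vanish; c
    accumulates once per step. *)
Lemma sum_le_shift_down d g e c n : 0 <= e -> g 0 = 0 ->
  (forall k, d k <= e * (g k.+1 - g (k - 2)%N) + c) ->
  \sum_(k < n) d k <= e * (g n + g (n - 1)%N + g (n - 2)%N) + c * n%:R.
Proof.
move=> e0 g0 dg; elim: n => [|n IH].
  by rewrite big_ord0 !sub0n g0 !addr0 !mulr0 addr0.
rewrite big_ord_recr /= -[n.+1%:R]natr1 subn1 -[n.+1.-1]/n.
by rewrite -[(n.+1 - 2)%N]/(n - 1)%N; have := dg n; lra.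
Qed.

Lemma increment_sub_le e a x y (d : R) : 0 <= e ->
  a <= e * (1 - 2 * x) -> d <= y -> a - e * (1 - 2 * d) <= 2 * e * (y - x).
Proof. by move=> e0 h /(ler_wpM2l e0); lra. Qed.

Lemma increment_sub_ge e a x y (z d : R) : 0 <= e ->
  e * (1 - 2 * x) <= a -> y - z <= d ->
  - (a - e * (1 - 2 * d)) <= 2 * e * (x - y) + 2 * e * z.
Proof. by move=> e0 h /(ler_wpM2l e0); lra. Qed.

(** Both a and e (1 - 2 d) lie in [0, e]. *)
Lemma norm_sub_le_half e a x y (d : R) : 0 <= e -> 0 <= x -> y <= 2^-1 ->
  0 <= d <= 2^-1 -> e * (1 - 2 * y) <= a <= e * (1 - 2 * x) ->
  `|a - e * (1 - 2 * d)| <= e.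
Proof.
move=> e0 x0 y1 /andP[d0 d1] /andP[a0 a1].
have ed : 0 <= e * d by rewrite mulr_ge0.
have ex : 0 <= e * x by rewrite mulr_ge0.
have ed1 : e * d <= e * 2^-1 by rewrite ler_wpM2l.
have ey1 : e * y <= e * 2^-1 by rewrite ler_wpM2l.
by rewrite ler_norml; apply/andP; split; lra.
Qed.

Lemma norm_le_shifts e a x x0 x1 x2 x3 x4 x5 (b : R) : 0 <= e -> 0 <= b ->
  a <= e * (x1 + x2 + x0) -> - (e * (x3 + x4 + x5) + b) <= a ->
  x1 <= x -> x2 <= x -> x0 <= x -> x3 <= x -> x4 <= x -> x5 <= x ->
  `|a| <= 3 * e * x + b.
Proof.
move=> e0 b0 au al h1 h2 h0 h3 h4 h5.
have k1 : e * (x1 + x2 + x0) <= e * (3 * x) by rewrite ler_wpM2l//; lra.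
have k2 : e * (x3 + x4 + x5) <= e * (3 * x) by rewrite ler_wpM2l//; lra.
by rewrite ler_norml; apply/andP; split; lra.
Qed.

End Telescope.

(** * Comparison of the values *)

Section Comparison.
Context {R : realType}.
Context (eps : R) (eps01 : 0 < eps < 1).
Implicit Types (k m T : nat).

Local Notation kap := (kappa_ eps).

Let eps0 : 0 < eps. Proof. by case/andP: eps01. Qed.

Lemma kappa_gt0 : 0 < kap.
Proof. by case/andP: eps01 => e0 e1; rewrite subr_gt0 expr_lt1// ltW. Qed.

Lemma kappa_lt1 : kap < 1.
Proof. by rewrite ltrBlDr ltrDl exprn_gt0. Qed.

(** As kappa = 1 - eps^2, this is the scale x / sqrt(1 - x^2) of [walk_defect_le_herf] at x =
    eps. *)
Definition slope : R := eps / Num.sqrt kap.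

Definition node k : R := slope * Num.sqrt (k%:R / 2).

Let skap_gt0 : 0 < Num.sqrt kap.
Proof. by rewrite sqrtr_gt0 kappa_gt0. Qed.

Let skap2 : Num.sqrt kap ^+ 2 = kap.
Proof. by rewrite sqr_sqrtr// ltW// kappa_gt0. Qed.

Let slope_gt0 : 0 < slope.
Proof. by rewrite divr_gt0. Qed.

Let node_sqr k : node k ^+ 2 = eps ^+ 2 / kap * (k%:R / 2).
Proof.
by rewrite exprMn expr_div_n skap2 sqr_sqrtr// divr_ge0.
Qed.

Lemma ubar_profile T : (1 <= T)%N ->
  ubar eps kap kap (kap / eps) (eps * T%:R) 0 (- T%:R) =
  2 * kap / eps * profile (node T).
Proof.
move=> T1; have T0 : 0 < T%:R :> R by rewrite ltr0n.
pose k := Num.sqrt kap; pose r : R := Num.sqrt (T%:R / 2).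
have k0 : k != 0 by exact: lt0r_neq0.
have r0 : 0 < r by rewrite sqrtr_gt0 divr_gt0.
have r'0 : r != 0 by exact: lt0r_neq0.
have e'0 : eps != 0 by exact: lt0r_neq0.
have p0 := lt0r_neq0 (@sqrt_pi_gt0 R).
have r2 : r ^+ 2 = T%:R / 2 by rewrite sqr_sqrtr// ltW// divr_gt0.
have TE : T%:R = 2 * r ^+ 2 by rewrite r2; field.
(* This is sqrt(2 kappa T), the width of the heat kernel, written so that [field] sees no square
   root. *)
pose L := 2 * k * r.
have L0 : 0 < L by rewrite !mulr_gt0.
pose c := eps * T%:R.
have c0 : 0 <= c by rewrite mulr_ge0// ltW.
have cL : c / L = node T.
  rewrite /c /L TE /node /slope -/k -/r; field.
  by rewrite r'0 k0.
have b0 : 0 <= kap / eps by rewrite divr_ge0// ltW// kappa_gt0.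
have sL : Num.sqrt (- 2 * pi * kap * - T%:R) = L * Num.sqrt pi.
  rewrite -[RHS]gtr0_norm ?mulr_gt0 ?sqrt_pi_gt0// -sqrtr_sqr; congr Num.sqrt.
  rewrite exprMn sqr_sqrtr ?pi_ge0// /L TE -skap2 -/k; ring.
have PhiE s : Phi kap (c - s) (- T%:R) = gauss ((s - c) / L) / L.
  rewrite /Phi sL /gauss.
  have -> : (c - s) ^+ 2 / (2 * kap * - T%:R) = - ((s - c) / L) ^+ 2.
    by rewrite /L TE -skap2 -/k; field; rewrite r'0 k0.
  by field; rewrite p0 lt0r_neq0.
rewrite /ubar mulr0 add0r -/c.
(* The start satisfies xi + eps t = 0, where [phibar] vanishes, so only the integral remains. *)
rewrite (_ : c + _ = 0) /phibar; last by rewrite /c; ring.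
rewrite lexx mulr0 sub0r.
rewrite (@integral_two_sided _ L (kap / eps) c) //.
- rewrite cL /profile.
  have LE : L = 2 * kap / eps * node T.
    by rewrite /L /node /slope -/k -/r -skap2 -/k; field; rewrite k0 e'0.
  have cE : c = 2 * kap / eps * node T ^+ 2.
    have -> : c = L * node T by rewrite -cL; field; rewrite lt0r_neq0.
    rewrite LE; ring.
  rewrite LE; rewrite {1 2}cE; ring.
- by move=> s s0; rewrite PhiE s0; ring.
- move=> s s0; rewrite PhiE leNgt s0 /=.
  (* Completing the square: with sigma = kappa the exponential factor of [phibar] moves the centre
     of the Gaussian from c to - c. *)
  have -> : gauss ((s + c) / L) =
      gauss ((s - c) / L) * expR (- 2 * eps * s / kap).
    rewrite /gauss mulrAC -expRD; congr (expR _ / _).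
    by rewrite /L /c TE -skap2 -/k; field; rewrite r'0 k0.
  ring.
Qed.

Let node_le j k : (j <= k)%N -> node j <= node k.
Proof.
move=> jk; rewrite ler_pM2l// ler_sqrt ?divr_ge0//.
by rewrite ler_pM2r ?invr_gt0// ler_nat.
Qed.

Let node0 : node 0 = 0.
Proof. by rewrite /node mul0r sqrtr0 mulr0. Qed.

Let node_ge0 k : 0 <= node k.
Proof. by rewrite -node0 node_le. Qed.

Let gamma k := herf (node k).

Let gamma_le j k : (j <= k)%N -> gamma j <= gamma k.
Proof. by move=> /node_le; exact: herf_le. Qed.

Let gamma0 : gamma 0 = 0.
Proof. by rewrite /gamma node0 herf0. Qed.

Let gamma_ge0 k : 0 <= gamma k.
Proof. by rewrite -gamma0 gamma_le. Qed.

Let eps_unit : 0 <= eps <= 1.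
Proof. by case/andP: eps01 => e0 e1; rewrite !ltW. Qed.

Lemma defect_ge0 k : 0 <= defect eps k.
Proof. by case: k => [|k] //=; exact: walk_defect_ge0. Qed.

Lemma defect_le_half k : defect eps k <= 2^-1.
Proof.
by case: k => [|k] /=; [rewrite invr_ge0 | exact: walk_defect_le_half].
Qed.

(** At time k + 1, m = k / 2 rounded down satisfies 2 (m + 2) <= k + 4; this is the shift by
    three. *)
Let defect_upper k : defect eps k <= gamma k.+3.
Proof.
case: k => [|k] /=; first exact: gamma_ge0.
have e01 : 0 <= eps < 1 by case/andP: eps01 => e0 e1; rewrite ltW.
apply: (le_trans (walk_defect_le_herf k./2 e01)); apply: herf_le.
rewrite -/(kappa_ eps) -/slope ler_pM2l// ler_sqrt ?divr_ge0//.
by rewrite ler_pdivlMr// -natrM ler_nat; lia.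
Qed.

(** Rounding in the halving of the time costs the index shift. Replacing [slope] by eps inside
    [herf] costs at most 1 / sqrt(kappa) - 1, hence at most 1 / kappa - 1 = eps^2 / kappa. *)
Let defect_lower k : gamma (k - 2) - eps ^+ 2 / kap <= defect eps k.
Proof.
have K0 := kappa_gt0.
have E0 : 0 <= eps ^+ 2 / kap by rewrite divr_ge0 ?sqr_ge0// ltW.
case: k => [|k] /=; first by rewrite gamma0; lra.
apply: le_trans (herf_le_walk_defect k./2 eps_unit).
set s : R := Num.sqrt _; have s0 : 0 <= s by exact: sqrtr_ge0.
have g1 : gamma (k.+1 - 2) <= herf (slope * s).
  apply: herf_le; rewrite ler_pM2l// ler_sqrt//.
  by rewrite ler_pdivrMr// -natrM ler_nat; lia.
have es : 0 <= eps * s by rewrite mulr_ge0// ltW.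
have k1 : Num.sqrt kap <= 1.
  rewrite -sqrtr1 ler_sqrt//; exact/ltW/kappa_lt1.
have i1 : 1 <= (Num.sqrt kap)^-1 by rewrite invf_ge1.
have ss : eps * s <= slope * s.
  by rewrite ler_wpM2r// ler_peMr// ltW.
have g2 := herfB_le es ss.
have -> : eps ^+ 2 / kap = (Num.sqrt kap)^-1 ^+ 2 - 1.
  by rewrite exprVn skap2 /kappa_; field; exact: lt0r_neq0 kappa_gt0.
have g3 : (slope * s - eps * s) * gauss (eps * s) <= (Num.sqrt kap)^-1 ^+ 2 - 1.
  have -> : (slope * s - eps * s) * gauss (eps * s) =
      ((Num.sqrt kap)^-1 - 1) * (eps * s * gauss (eps * s)).
    by rewrite /slope; ring.
  have g4 := mul_gauss_le1 es.
  have g5 : 0 <= eps * s * gauss (eps * s) 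
    by rewrite mulr_ge0// ltW// gauss_gt0.
  nra.
lra.
Qed.

Let U k := 2 * kap / eps * profile (node k).

Let U_increment k :
  eps * (1 - 2 * gamma k.+1) <= U k.+1 - U k <= eps * (1 - 2 * gamma k).
Proof.
have K0 := kappa_gt0.
have /andP[] := profile_increment (node_ge0 k) (node_le (leqnSn k)).
have -> : node k.+1 ^+ 2 - node k ^+ 2 = eps / (2 * kap / eps).
  by rewrite !node_sqr -natr1; field; rewrite !lt0r_neq0.
have c0 : 0 < 2 * kap / eps by rewrite divr_gt0// mulr_gt0.
rewrite /U -mulrBr; set c := 2 * kap / eps in c0 *; set d := _ - profile _.
move=> h1 h2; have E x : eps * x = c * (x * (eps / c)).
  by field; exact: lt0r_neq0.
by rewrite (E (1 - 2 * gamma k.+1)) (E (1 - 2 * gamma k)) !ler_pM2l// h1 h2.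
Qed.

Let error T := U T - vbar eps T (eps * T%:R) 0.

Let errorE T : error T =
  \sum_(k < T) (U k.+1 - U k - eps * (1 - 2 * defect eps k)).
Proof.
rewrite /error vbar_defect sumrB; congr (_ - _).
elim: T => [|T IH]; first by rewrite big_ord0 /U node0 profile0 mulr0.
by rewrite big_ord_recr /= -IH addrC subrK.
Qed.

Let error_le_trivial T : `|error T| <= eps * T%:R.
Proof.
rewrite errorE; apply: (le_trans (ler_norm_sum _ _ _)).
rewrite -[T in leRHS]card_ord -sum1_card natr_sum mulr_sumr.
apply: ler_sum => k _; rewrite mulr1.
apply: (norm_sub_le_half (ltW eps0) (gamma_ge0 k) (herf_le_half _)) => //.
  by rewrite defect_ge0 defect_le_half.
exact: U_increment.
Qed.

(* The bounds on the defect shift the index of [gamma] by at most three, so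
   that the sum over the time steps telescopes. *)
Let error_le_telescope T :
  `|error T| <= 6 * eps * herf (node T.+2) + 2 * eps ^+ 3 / kap * T%:R.
Proof.
have e0 : 0 <= 2 * eps by rewrite mulr_ge0// ltW.
have c0 : 0 <= 2 * eps ^+ 3 / kap.
  by rewrite divr_ge0 ?mulr_ge0 ?exprn_ge0// ltW// kappa_gt0.
have -> : 6 * eps = 3 * (2 * eps) by ring.
have gT j : (j <= T.+2)%N -> herf (node j) <= herf (node T.+2).
  exact: gamma_le.
apply: (norm_le_shifts e0 (x1 := gamma T.+1) (x2 := gamma T.+2) (x0 := gamma T)
  (x3 := gamma T)  (x4 := gamma (T - 1)) (x5 := gamma (T - 2))).
- by rewrite mulr_ge0.
- rewrite errorE; 
  apply: (@sum_le_shift_up _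
    (fun k => U k.+1 - U k - eps * (1 - 2 * defect eps k))
    gamma _ T e0 gamma_ge0) => k.
  have /andP[_ u2] := U_increment k.
  exact: (increment_sub_le (ltW eps0) u2 (defect_upper k)).
- rewrite lerNl errorE -sumrN.
  apply: (@sum_le_shift_down _
    (fun k => - (U k.+1 - U k - eps * (1 - 2 * defect eps k)))
    gamma _ _ T e0 gamma0) => k.
  have /andP[u1 _] := U_increment k.
  rewrite (_ : 2 * eps ^+ 3 / kap = 2 * eps * (eps ^+ 2 / kap)); last by ring.
  exact: (increment_sub_ge (ltW eps0) u1 (defect_lower k)).
- exact: gT (leqnSn _).
- exact: gT (leqnn _).
- exact: gT (leqW (leqnSn _)).
- exact: gT (leqW (leqnSn _)).
- by apply: gT; exact: leq_trans (leq_subr _ _) (leqW (leqnSn T)).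
- by apply: gT; exact: leq_trans (leq_subr _ _) (leqW (leqnSn T)).
Qed.

Definition value_gap T : R :=
  `|ubar eps kap kap (kap / eps) (eps * T%:R) 0 (- T%:R)
    - vbar eps T (eps * T%:R) 0|.

Lemma value_gap_le_trivial T : (1 <= T)%N -> value_gap T <= eps * T%:R.
Proof.
by move=> T1; rewrite /value_gap ubar_profile//; exact: error_le_trivial.
Qed.

Lemma value_gap_le T : (1 <= T)%N ->
  value_gap T <= 6 * eps * herf (node T.+2) + 2 * eps ^+ 3 / kap * T%:R.
Proof.
by move=> T1; rewrite /value_gap ubar_profile//; exact: error_le_telescope.
Qed.

End Comparison.

(** * The rate *)

Section ExpTaylor.
Context {R : realType}.
Implicit Types (x y z : R) (n : nat).

(** The Taylor polynomial of [expR] with n terms, hence of degree n - 1. *)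
Definition exp_poly n x : R := \sum_(i < n) x ^+ i / i`!%:R.

Lemma exp_poly0 n : exp_poly n.+1 0 = 1.
Proof.
rewrite /exp_poly big_ord_recl big1 ?addr0 => [|i _].
  by rewrite expr0 fact0 divr1.
by rewrite expr0n mul0r.
Qed.

Lemma exp_poly_der n x : has_derive x (exp_poly n.+1) (exp_poly n x).
Proof.
elim: n => [|n IH].
  have -> : exp_poly 1 = (fun=> 1 : R).
    by apply/funext => t; rewrite /exp_poly big_ord1 expr0 fact0 divr1.
  by rewrite /exp_poly big_ord0; exact: der_cst.
have -> : exp_poly n.+2 = (fun t => exp_poly n.+1 t + t ^+ n.+1 / n.+1`!%:R).
  by apply/funext => t; rewrite [LHS]/exp_poly big_ord_recr.
apply: der_eq; first by apply: der_add; [exact: IH | der].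
rewrite [RHS]/exp_poly big_ord_recr /= -/(exp_poly n x); congr (_ + _).
have f0 : n`!%:R != 0 :> R by rewrite pnatr_eq0 -lt0n fact_gt0.
have n0 : n.+1%:R != 0 :> R by rewrite pnatr_eq0.
rewrite factS natrM mulr0 add0r mulr1 invfM /=; set N : R := n.+1%:R in n0 *.
by rewrite mulrACA mulVf ?mul1r 1?mulrC.
Qed.

Lemma exp_sub_der n x : has_derive x (fun t => expR t - exp_poly n.+1 t)
  (expR x - exp_poly n x).
Proof.
apply: der_eq.
  apply: der_add; first by der.
  by apply: der_opp; exact: exp_poly_der.
by rewrite mulr1.
Qed.

Lemma exp_poly_le n x : 0 <= x -> exp_poly n x <= expR x.
Proof.
elim: n x => [|n IH] x x0; first by rewrite /exp_poly big_ord0 expR_ge0.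
have : expR 0 - exp_poly n.+1 0 <= expR x - exp_poly n.+1 x.
  apply: (der_ge0_le x0 (fun z _ => exp_sub_der n z)) => z /andP[z0 _].
  by rewrite subr_ge0 IH.
by rewrite expR0 exp_poly0 subrr subr_ge0.
Qed.

Lemma expR_le4 x : x <= 1 -> expR x <= 4.
Proof.
move=> x1; apply: (@le_trans _ _ (expR 1)); first by rewrite ler_expR.
have h : 2^-1 <= expR (- 2^-1 : R) by have := expR_ge1Dx (- 2^-1 : R); lra.
have -> : expR 1 = (expR (- 2^-1))^-1 ^+ 2 :> R.
  by rewrite -expRN opprK -expRM_natl mulfV.
have -> : 4 = 2 ^+ 2 :> R by rewrite -natrX.
apply: lerXn2r; rewrite ?nnegrE ?invr_ge0 ?expR_ge0//.
by rewrite -[leRHS]invrK lef_pV2 ?posrE ?expR_gt0.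
Qed.

(** The remainder differentiates to the remainder of lower order, so each use of the mean value
    theorem gains a factor x; 4 bounds [expR] on the range. *)
Lemma exp_taylor n x : `|x| <= 1 -> `|expR x - exp_poly n x| <= 4 * `|x| ^+ n.
Proof.
elim: n x => [|n IH] x x1.
  rewrite /exp_poly big_ord0 subr0 expr0 mulr1 ger0_norm ?expR_ge0//.
  by apply: expR_le4; exact: le_trans (ler_norm x) x1.
have f0 : expR 0 - exp_poly n.+1 0 = 0 by rewrite expR0 exp_poly0 subrr.
have step c : `|c| <= `|x| ->
    expR x - exp_poly n.+1 x = (expR c - exp_poly n c) * x ->
    `|expR x - exp_poly n.+1 x| <= 4 * `|x| ^+ n.+1.
  move=> cx ->; rewrite normrM exprSr mulrA ler_wpM2r//.
  apply: (le_trans (IH c (le_trans cx x1))).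
  by rewrite ler_pM2l// lerXn2r ?nnegrE.
have [x0|x0|->] := ltgtP x 0; last first.
- by rewrite f0 normr0 mulr_ge0.
- have [c /andP[c0 cx] e] := mean_value x0 (fun z _ => exp_sub_der n z).
  apply: (step c); first by rewrite !ger0_norm// ltW.
  by move: e; rewrite f0 !subr0.
- have [c /andP[xc c0] e] := mean_value x0 (fun z _ => exp_sub_der n z).
  apply: (step c); first by rewrite !ler0_norm ?lerN2// ltW.
  by move: e; rewrite f0 !sub0r mulrN => /oppr_inj.
Qed.

Lemma exp_poly3E x : exp_poly 3 x = 1 + x + x ^+ 2 / 2.
Proof.
rewrite /exp_poly !big_ord_recr big_ord0 /= add0r expr0 expr1.
by rewrite -[0`!%:R]/(1 : R) -[2`!%:R]/(2 : R) !divr1.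
Qed.

Lemma exp_poly4E x : exp_poly 4 x = 1 + x + x ^+ 2 / 2 + x ^+ 3 / 6.
Proof.
by rewrite /exp_poly big_ord_recr -/(exp_poly 3 x) exp_poly3E.
Qed.

Lemma exp_poly5E x :
  exp_poly 5 x = 1 + x + x ^+ 2 / 2 + x ^+ 3 / 6 + x ^+ 4 / 24.
Proof.
by rewrite /exp_poly big_ord_recr -/(exp_poly 4 x) exp_poly4E.
Qed.

Lemma exp_poly6E x : exp_poly 6 x =
  1 + x + x ^+ 2 / 2 + x ^+ 3 / 6 + x ^+ 4 / 24 + x ^+ 5 / 120.
Proof.
by rewrite /exp_poly big_ord_recr -/(exp_poly 5 x) exp_poly5E.
Qed.

End ExpTaylor.

(** * Lower bounds for the coefficients of T in the rate *)

Section RateLowerBounds.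
Context {R : realType}.
Context (eps : R) (eps01 : 0 < eps < 1).
Implicit Types (x y z t : R) (T : nat).

Local Notation kap := (kappa_ eps).

Let eps0 : 0 < eps. Proof. by case/andP: eps01. Qed.
Let eps1 : eps < 1. Proof. by case/andP: eps01. Qed.
Let kap0 : 0 < kap. Proof. exact: kappa_gt0. Qed.
Let kapE : kap = (1 - eps) * (1 + eps). Proof. by rewrite /kappa_; ring. Qed.

Let u : R := eps / kap.

Let u_gt0 : 0 < u. Proof. by rewrite divr_gt0. Qed.

Let uE : eps = u * kap. Proof. by rewrite /u divfK// lt0r_neq0. Qed.

Let nuE : nu eps =
  (1 - eps) / 2 * expR (2 * u) + (1 + eps) / 2 * expR (- (2 * u)) - 1.
Proof.
rewrite /nu /u.
have -> : - 2 * eps / kap = - (2 * (eps / kap)) by ring.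
have -> : 2 * eps / kap = 2 * (eps / kap) by ring.
by ring.
Qed.

Let rhoE : kap / eps * rho eps + 1 =
  1 - (1 + eps) * (1 - expR (- (2 * u))) / (2 * u).
Proof.
rewrite /rho; have -> : - 2 * eps / kap = - (2 * u) by rewrite /u; ring.
have -> : kap / eps = u^-1 by rewrite /u invf_div.
by field; rewrite lt0r_neq0.
Qed.

(** With E = exp(2 u), E nu = (E - 1) ((1 - eps) E - (1 + eps)) / 2; the second factor is
    nonnegative by the quadratic Taylor bound and eps <= u. *)
Lemma nu_ge0 : 0 <= nu eps.
Proof.
have u0 : 0 <= 2 * u by rewrite mulr_ge0// ltW.
have := exp_poly_le 3 u0; rewrite exp_poly3E nuE => hE.
set E := expR _ in hE *; set E' := expR _.
have EE' : E * E' = 1 by exact: expRxMexpNx_1.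
have E1 : 1 <= E by have := sqr_ge0 (2 * u); lra.
have h : 1 + eps <= (1 - eps) * E.
  apply: (@le_trans _ _ ((1 - eps) * (1 + 2 * u + (2 * u) ^+ 2 / 2)));
      last first.
    by rewrite ler_pM2l// subr_gt0.
  have d : 0 < 1 + eps by rewrite addr_gt0.
  rewrite -(ler_pM2r d) mulrAC -kapE.
  have -> : kap * (1 + 2 * u + (2 * u) ^+ 2 / 2) = kap + 2 * eps + 2 * eps * u.
    transitivity (kap + 2 * (u * kap) + 2 * (u * kap) * u); first by field.
    by rewrite -uE.
  have eu : eps <= u.
    by rewrite ler_pdivlMr// ler_piMr// ?(ltW eps0)// ltW// kappa_lt1.
  have eu2 : eps * eps <= eps * u by rewrite ler_pM2l.
  have -> : kap = 1 - eps * eps by [].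
  by move: eu2; set v := u; lra.
have E0 : 0 < E by exact: expR_gt0.
rewrite -(pmulr_lge0 _ E0).
have -> : ((1 - eps) / 2 * E + (1 + eps) / 2 * E' - 1) * E =
    (1 - eps) / 2 * E ^+ 2 + (1 + eps) / 2 * (E * E') - E by ring.
rewrite EE'; nra.
Qed.

(** The difference and its derivative vanish at 0, and the second derivative is 4 t (exp(2 t) - 1)
    >= 0. *)
Let exp_cubic z : 0 <= z -> 2 / 3 * z ^+ 3 <= 1 + z - (1 - z) * expR (2 * z).
Proof.
move=> z0.
have d2 t : has_derive t (fun t => 1 - 2 * t ^+ 2 - (1 - 2 * t) * expR (2 * t))
    (4 * t * (expR (2 * t) - 1)).
  by apply: der_eq; [der | rewrite /=; ring].
have h1 t : 0 <= t -> 0 <= 1 - 2 * t ^+ 2 - (1 - 2 * t) * expR (2 * t).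
  move=> t0; have := der_ge0_le t0 (fun z _ => d2 z).
  rewrite !mulr0 expR0 expr0n /= !mulr0 !subr0 mulr1 subrr; apply.
  move=> y /andP[y0 _]; rewrite mulr_ge0 ?mulr_ge0// subr_ge0.
  by have := expR_ge1Dx (2 * y); lra.
have d1 t : has_derive t
    (fun t => 1 + t - (1 - t) * expR (2 * t) - 2 / 3 * t ^+ 3)
    (1 - 2 * t ^+ 2 - (1 - 2 * t) * expR (2 * t)).
  by apply: der_eq; [der | rewrite /=; field].
have := der_ge0_le z0 (fun z _ => d1 z).
rewrite !mulr0 expR0 expr0n /= !mulr0 !subr0 addr0 mulr1 subrr => h.
rewrite -subr_ge0; apply: h => y /andP[y0 _]; exact: h1.
Qed.

(** The decrease of (1 - exp(- x)) / x, cross-multiplied; it allows u = eps / kappa to be replaced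
    by the smaller eps. *)
Let exp_slope_anti x y : 0 < x -> x <= y ->
  x * (1 - expR (- y)) <= y * (1 - expR (- x)).
Proof.
move=> x0 xy.
have d t : has_derive t (fun t => t * (1 - expR (- x)) - x * (1 - expR (- t)))
    (1 - expR (- x) - x * expR (- t)).
  by apply: der_eq; [der | rewrite /=; ring].
have := der_ge0_le xy (fun z _ => d z); rewrite subrr subr_ge0; apply.
move=> z /andP[xz _].
have e1 : expR (- z) <= expR (- x) by rewrite ler_expR lerN2.
have e2 := expRxMexpNx_1 x; have e3 := expR_ge1Dx x.
have e4 := expR_gt0 (- x); nra.
Qed.

(** The constant is 2/3 from [exp_cubic], times 1/16 <= exp(- 2 eps), divided by the factor 2 of 2
    eps. *)
Lemma rho_ge : eps ^+ 2 / 48 <= kap / eps * rho eps + 1.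
Proof.
rewrite rhoE.
have eu : 2 * eps <= 2 * u.
  by rewrite ler_pM2l// ler_pdivlMr// ler_piMr// ltW// kappa_lt1.
have e0 : 0 < 2 * eps by rewrite mulr_gt0.
have u0 : 0 < 2 * u by rewrite mulr_gt0.
have h := exp_slope_anti e0 eu.
have h2 : (1 - expR (- (2 * u))) / (2 * u) <=
    (1 - expR (- (2 * eps))) / (2 * eps).
  by rewrite ler_pdivrMr// mulrAC ler_pdivlMr// mulrC [leRHS]mulrC.
apply: (@le_trans _ _ (1 - (1 + eps) * ((1 - expR (- (2 * eps))) / (2 * eps)))).
  rewrite -(ler_pM2r e0).
  have -> : (1 - (1 + eps) * ((1 - expR (- (2 * eps))) / (2 * eps))) * (2 * eps)
      = (1 + eps) * expR (- (2 * eps)) - (1 - eps).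
    by field; rewrite lt0r_neq0.
  have c := exp_cubic (ltW eps0).
  have E1 := expRxMexpNx_1 (2 * eps).
  have E0 := expR_gt0 (- (2 * eps)).
  have E16 : 16^-1 <= expR (- (2 * eps)).
    rewrite expRN lef_pV2 ?posrE ?expR_gt0// expRM_natl.
    have -> : 16 = 4 ^+ 2 :> R by rewrite -natrX.
    by rewrite lerXn2r ?nnegrE ?expR_ge0// expR_le4// ltW.
  have c2 : 2 / 3 * eps ^+ 3 * expR (- (2 * eps)) <=
      (1 + eps) * expR (- (2 * eps)) - (1 - eps).
    have -> : (1 + eps) * expR (- (2 * eps)) - (1 - eps) =
       (1 + eps - (1 - eps) * expR (2 * eps)) * expR (- (2 * eps)).
      rewrite mulrBl -mulrA E1; ring.
    by rewrite ler_pM2r.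
  apply: le_trans c2.
  have e3 : 0 < eps ^+ 3 by rewrite exprn_gt0.
  have := ler_pM2l e3 16^-1 (expR (- (2 * eps))); rewrite E16 => h16.
  have -> : eps ^+ 2 / 48 * (2 * eps) = eps ^+ 3 / 24 by field.
  lra.
rewrite lerD2l lerN2 -mulrA ler_pM2l//.
by rewrite addr_gt0.
Qed.

End RateLowerBounds.

(** * Domination of the gap by the rates *)

Section RateComparison.
Context {R : realType}.
Context (eps : R) (eps01 : 0 < eps < 1).
Implicit Types (x y z t A B : R) (T : nat).

Local Notation kap := (kappa_ eps).

Let eps0 : 0 < eps. Proof. by case/andP: eps01. Qed.
Let eps1 : eps < 1. Proof. by case/andP: eps01. Qed.
Let kap0 : 0 < kap. Proof. exact: kappa_gt0. Qed.

(** A common minorant of both rates in their regular range: ln T >= 1/2 for T >= 2, while the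
    logarithmic part vanishes at T = 1. *)
Definition rate_floor T : R := eps / 2 *+ (1 < T)%N + eps ^+ 2 / 48 * T%:R.

Let rate_floor_le T A B : (1 <= T)%N -> 1 <= A -> eps ^+ 2 / 48 <= B ->
  rate_floor T <= eps * Num.min A (ln T%:R) + B * T%:R.
Proof.
move=> T1 A1 B1; apply: lerD; last by rewrite ler_wpM2r.
case: ltnP => T2.
  have T0 : 2 <= T%:R :> R by rewrite ler_nat.
  have h : 2^-1 <= ln T%:R :> R.
    apply: (@le_trans _ _ (ln 2)); last first.
      by rewrite ler_ln ?posrE// (lt_le_trans _ T0).
    have := @le_ln1Dx R (- 2^-1).
    have -> : 1 + - 2^-1 = 2^-1 :> R by field.
    rewrite lnV ?posrE// lerNl opprK; apply.
    by lra.
  rewrite mulr1n ler_pM2l// le_min h andbT; lra.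
have -> : T = 1%N by apply/eqP; rewrite eqn_leq T2 T1.
by rewrite mulr0n ln1 mulr_ge0 ?(ltW eps0)// le_min lexx andbT; lra.
Qed.

(** For eps <= 1/2 one has eps <= kappa, so the logarithm of kappa^2 / eps^2 is nonnegative. *)
Lemma rate_ge_floor T : (1 <= T)%N -> eps <= 2^-1 -> rate_floor T <= rate eps T.
Proof.
move=> T1 e2; apply: rate_floor_le => //.
  rewrite lerDr ln_ge0// -expr_div_n.
  have : 1 <= kap / eps.
    by rewrite ler_pdivlMr// mul1r /kappa_; have := eps0; nra.
  exact: exprn_ege1.
rewrite -addrA; have := rho_ge eps01 => h; apply: (le_trans h).
by rewrite lerDr mulr_ge0 ?nu_ge0// divr_ge0// ltW.
Qed.

Lemma rate0_ge_floor T : (1 <= T)%N -> rate_floor T <= rate0 eps T.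
Proof.
move=> T1; apply: rate_floor_le => //.
  rewrite lerDr ln_ge0// ler_pdivlMr ?exprn_gt0// mul1r.
  by rewrite expr_le1 ?ltW.
by have := sqr_ge0 eps; lra.
Qed.

(** For T >= 2 the bound [herf <= 1/2] suffices. At T = 1 the floor is only of order eps^2, and
    [herf (node 3) <= 2 eps] supplies the second factor eps. *)
Lemma value_gap_le_floor T : (1 <= T)%N -> eps <= 2^-1 ->
  value_gap eps T <= 10 ^+ 3 * rate_floor T.
Proof.
move=> T1 e2; apply: (le_trans (value_gap_le eps01 T1)).
have k34 : 3 / 4 <= kap by rewrite /kappa_; have := eps0; nra.
have e2_ge0 := sqr_ge0 eps.
have i43 : kap^-1 <= 4 / 3.
  by rewrite -[leRHS]invf_div lef_pV2 ?posrE// divr_gt0.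
have c : 2 * eps ^+ 3 / kap * T%:R <= 64 * (eps ^+ 2 / 48 * T%:R).
  rewrite mulrA ler_wpM2r//.
  have -> : 2 * eps ^+ 3 / kap = (2 * eps * kap^-1) * eps ^+ 2 by ring.
  have -> : 64 * (eps ^+ 2 / 48) = 4 / 3 * eps ^+ 2 by field.
  rewrite ler_wpM2r//.
  have i0 : 0 < kap^-1 by rewrite invr_gt0.
  have := eps0; nra.
have T0 : 1 <= T%:R :> R by rewrite ler1n.
rewrite /rate_floor; case: ltnP => T2.
  have := herf_le_half (node eps T.+2); rewrite mulr1n => h.
  have h2 : 6 * eps * herf (node eps T.+2) <= 6 * eps * 2^-1.
    by rewrite ler_pM2l// mulr_gt0.
  have : 0 <= eps ^+ 2 / 48 * T%:R by rewrite mulr_ge0// divr_ge0.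
  by have := eps0; lra.
have T1' : T = 1%N by apply/eqP; rewrite eqn_leq T2 T1.
have n0 : 0 <= node eps 3.
  apply: mulr_ge0; rewrite ?sqrtr_ge0//.
  by apply: divr_ge0; rewrite ?sqrtr_ge0// ltW.
have hn : herf (node eps 3) <= node eps 3.
  have := herfB_le (lexx 0) n0; rewrite herf0 !subr0 => /le_trans; apply.
  by rewrite ler_piMr// gauss_le1.
have n2 : node eps 3 <= 2 * eps.
  rewrite -[node _ _]ger0_norm// -sqrtr_sqr -[2 * eps]ger0_norm; last first.
    by rewrite mulr_ge0// ltW.
  rewrite -sqrtr_sqr ler_sqrt ?sqr_ge0//.
  rewrite /node /slope !exprMn exprVn !sqr_sqrtr ?(ltW kap0) ?divr_ge0//.
  have -> : eps ^+ 2 / kap * (3%:R / 2) = (kap^-1 * (3 / 2)) * eps ^+ 2 by ring.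
  rewrite ler_wpM2r//; lra.
move: c; rewrite T1' mulr0n add0r !mulr1 => c.
have h3 : 6 * eps * herf (node eps 3) <= 6 * eps * (2 * eps).
  by rewrite ler_pM2l ?mulr_gt0// (le_trans hn).
have -> : 10 ^+ 3 * (eps ^+ 2 / 48) =
    64 * (eps ^+ 2 / 48) + 6 * eps * (2 * eps) + 15 / 2 * eps ^+ 2.
  by field.
by have := sqr_ge0 eps; lra.
Qed.

(** Isolates the numerical core of [nu_ge_ln]: y, l, i, E stand for u, ln u, 1 / eps, exp(2 u). *)
Let quintic_bound y l i E : 8 / 5 < y -> l <= y - 1 -> i <= 10 / 7 ->
  1 + 2 * y + (2 * y) ^+ 2 / 2 + (2 * y) ^+ 3 / 6 + (2 * y) ^+ 4 / 24 +
    (2 * y) ^+ 5 / 120 <= E ->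
  0 <= 4 * y ^+ 2 * (1 - 2 * l) + E - 4 * y * i.
Proof.
clear; move=> y0 l0 i0 E0; have y1 : 0 < y by lra.
have t1 : y * i <= y * (10 / 7) by rewrite ler_pM2l.
have t2 : y ^+ 2 * (1 - 2 * (y - 1)) <= y ^+ 2 * (1 - 2 * l).
  by rewrite ler_pM2l ?exprn_gt0//; lra.
(* [11 / 5] is close to the minimiser of the cubic factor left over. *)
have t3 : 0 <= y ^+ 2 * ((y - 11 / 5) ^+ 2 * (y + 69 / 10)).
  by apply: mulr_ge0; [exact: sqr_ge0|apply: mulr_ge0; [exact: sqr_ge0|lra]].
have t4 : 0 <= y * (y - 8 / 5) by rewrite mulr_ge0//; lra.
have t5 : 0 <= y ^+ 2 * (y - 8 / 5) by rewrite mulr_ge0 ?sqr_ge0//; lra.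
lra.
Qed.

(* For [eps / kappa] so large that the logarithm in [rate] is negative, the
   exponential growth of [nu] compensates it. *)
Let nu_ge_ln : ln (kap ^+ 2 / eps ^+ 2) + 1 < 0 ->
  0 <= eps * (ln (kap ^+ 2 / eps ^+ 2) + 1) + kap / eps * nu eps.
Proof.
pose u := eps / kap; have u0 : 0 < u by rewrite divr_gt0.
have ku : kap / eps = u^-1 by rewrite /u invf_div.
have -> : ln (kap ^+ 2 / eps ^+ 2) = - (2 * ln u).
  rewrite -expr_div_n ku lnXn ?invr_gt0// lnV ?posrE//.
  by rewrite mulr2n; ring.
move=> A0; rewrite ku.
(* A negative logarithmic term means ln u > 1/2, and exp(1/2) >= 1 + 1/2 + 1/8 > 8/5. *)
have u32 : 8 / 5 < u.
  have l1 : 2^-1 < ln u by lra.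
  have : expR 2^-1 < u by rewrite -[ltRHS]lnK ?posrE// ltr_expR.
  apply: le_lt_trans; have i0 : 0 <= 2^-1 :> R by [].
  by apply: le_trans (exp_poly_le 3 i0); rewrite exp_poly3E; lra.
have e7 : 7 / 10 < eps.
  have uk : eps = u * kap by rewrite /u divfK// lt0r_neq0.
  have kk : kap = 1 - eps ^+ 2 by [].
  have : 8 / 5 * kap < eps by rewrite [ltRHS]uk ltr_pM2r.
  by rewrite kk; have := eps0; nra.
have lnu : ln u <= u - 1.
  have := @le_ln1Dx R (u - 1); rewrite addrCA subrr addr0; apply.
  by lra.
(* Only the growing exponential is kept, with (1 - eps) / 2 >= kappa / 4 because 1 + eps <= 2. *)
have nuL : expR (2 * u) * (eps / (4 * u)) - 1 <= nu eps.
  rewrite /nu.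
  have -> : 2 * eps / kap = 2 * u by rewrite /u mulrA.
  rewrite lerD2r; apply: ler_wpDl.
    by rewrite mulr_ge0 ?expR_ge0// divr_ge0// addr_ge0// ltW.
  rewrite ler_pM2l ?expR_gt0//.
  have -> : eps / (4 * u) = kap / 4 by rewrite /u; field; rewrite !lt0r_neq0.
  by rewrite /kappa_; have := eps0; have := eps1; nra.
have i0 : 0 <= u^-1 by rewrite invr_ge0 ltW.
have h := ler_wpM2l i0 nuL.
suff : 0 <= eps * (- (2 * ln u) + 1) +
    u^-1 * (expR (2 * u) * (eps / (4 * u)) - 1) by lra.
have -> : eps * (- (2 * ln u) + 1) +
    u^-1 * (expR (2 * u) * (eps / (4 * u)) - 1) =
    eps / (4 * u ^+ 2) *
    (4 * u ^+ 2 * (1 - 2 * ln u) + expR (2 * u) - 4 * u * eps^-1).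
  by field; rewrite !lt0r_neq0.
apply: mulr_ge0.
  by apply/ltW/divr_gt0 => //; rewrite mulr_gt0// exprn_gt0.
have u20 : 0 <= 2 * u by rewrite mulr_ge0// ltW.
have e10 : eps^-1 <= 10 / 7.
  by rewrite -[leRHS]invf_div lef_pV2 ?posrE// ?divr_gt0// ltW.
by have := exp_poly_le 6 u20; rewrite exp_poly6E; exact: quintic_bound.
Qed.

(** The [rho] part alone gives (1/2)^2 / 48 = 1/192 per step; a negative logarithm is absorbed by
    the [nu] part, since T >= 1. *)
Lemma rate_ge_large T : (1 <= T)%N -> 2^-1 <= eps -> T%:R / 192 <= rate eps T.
Proof.
move=> T1 e2; have T1' : 1 <= T%:R :> R by rewrite ler1n.
have T0 : 0 <= T%:R :> R by [].
have h1 : 192^-1 <= kap / eps * rho eps + 1.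
  by apply: le_trans (rho_ge eps01); have := eps0; nra.
have h2 : 0 <= kap / eps * nu eps.
  by rewrite mulr_ge0 ?nu_ge0// divr_ge0// ltW.
rewrite /rate -[kap / eps * nu eps + _ + 1]addrA.
have h3 := ler_wpM2r T0 h1.
set B := kap / eps * rho eps + 1 in h1 h3 *.
set N := kap / eps * nu eps in h2 *.
have lnT : 0 <= ln T%:R :> R by rewrite ln_ge0.
have NT : 0 <= N * T%:R by rewrite mulr_ge0.
have [A0|A0] := leP 0 (ln (kap ^+ 2 / eps ^+ 2) + 1).
  have : 0 <= eps * Num.min (ln (kap ^+ 2 / eps ^+ 2) + 1) (ln T%:R).
    by rewrite mulr_ge0 ?(ltW eps0)// le_min A0.
  by rewrite mulrDl; lra.
have -> : Num.min (ln (kap ^+ 2 / eps ^+ 2) + 1) (ln T%:R) =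
    ln (kap ^+ 2 / eps ^+ 2) + 1.
  by apply/min_idPl; apply: le_trans lnT; exact: ltW.
have := nu_ge_ln A0; rewrite -/N; set A := ln _ + 1 in A0 *.
move=> h4; have : N <= N * T%:R by rewrite ler_peMr.
by rewrite mulrDl; lra.
Qed.

(** Below eps = 1/2 both sides are compared with [rate_floor]; above it the trivial bound eps T is
    matched by the linear growth of the rate. *)
Lemma value_gap_le_rate T : (1 <= T)%N ->
  value_gap eps T <= 10 ^+ 3 * `|rate eps T|.
Proof.
move=> T1; have T0 : 0 <= T%:R :> R by [].
have [e2|e2] := leP eps 2^-1.
  apply: (le_trans (value_gap_le_floor T1 e2)); rewrite ler_pM2l ?exprn_gt0//.
  exact: le_trans (rate_ge_floor T1 e2) (ler_norm _).
apply: (le_trans (value_gap_le_trivial eps01 T1)).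
apply: (@le_trans _ _ (10 ^+ 3 * (T%:R / 192))).
  have : eps * T%:R <= T%:R by rewrite ler_piMl// ltW.
  by lra.
rewrite ler_pM2l ?exprn_gt0// (le_trans (rate_ge_large T1 (ltW e2)))//.
exact: ler_norm.
Qed.

Lemma value_gap_le_rate0 T : (1 <= T)%N -> eps <= 2^-1 ->
  value_gap eps T <= 10 ^+ 3 * `|rate0 eps T|.
Proof.
move=> T1 e2; apply: (le_trans (value_gap_le_floor T1 e2)).
rewrite ler_pM2l ?exprn_gt0//.
exact: le_trans (rate0_ge_floor T1) (ler_norm _).
Qed.

End RateComparison.

(** * Leading order terms *)

Section Asymptotics.
Context {R : realType}.
Implicit Types (f g : R -> R) (eps K x u : R).

Lemma equiv_at_right0 f g K : 0 < K ->
  (forall eps, 0 < eps <= 4^-1 -> `|f eps - g eps| <= K * eps * `|g eps|) ->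
  f ~_((0 : R)^'+) g.
Proof.
move=> K0 fg; apply/eqaddoP => e e0; near=> x.
have x0 : 0 < x by near: x; exact: nbhs_right_gt.
have x4 : x <= 4^-1 by near: x; apply: nbhs_right_le.
have xe : x <= e / K by near: x; apply: nbhs_right_le; rewrite divr_gt0.
apply: (le_trans (fg x _)); first by rewrite x0.
by rewrite ler_wpM2r// mulrC -ler_pdivlMr.
Unshelve. all: by end_near.
Qed.

(** For u = eps / kappa, the identity u - eps = u eps^2 shows that the two scales differ only at
    third order. *)
Let ratio_bounds eps : 0 < eps <= 4^-1 -> [/\ 0 < kappa_ eps,
  eps / kappa_ eps - eps = eps / kappa_ eps * eps ^+ 2,
  eps <= eps / kappa_ eps & eps / kappa_ eps <= 2 * eps].
Proof.
move=> /andP[e0 e4].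
have k2 : 2^-1 <= kappa_ eps by rewrite /kappa_; nra.
have k0 : 0 < kappa_ eps by apply: lt_le_trans k2.
have k1 : kappa_ eps <= 1 by rewrite /kappa_ gerBl sqr_ge0.
have kE : eps ^+ 2 = 1 - kappa_ eps by rewrite /kappa_; ring.
split=> //; first by rewrite kE; field; exact: lt0r_neq0.
  by rewrite ler_pdivlMr// ler_piMr// ltW.
rewrite ler_pdivrMr//; nra.
Qed.

Let exp_taylor5 x : `|x| <= 1 -> exists2 r, `|r| <= 4 * `|x| ^+ 5 &
  expR x = r + (1 + x + x ^+ 2 / 2 + x ^+ 3 / 6 + x ^+ 4 / 24).
Proof.
move=> x1; exists (expR x - exp_poly 5 x); first exact: exp_taylor.
by rewrite -exp_poly5E subrK.
Qed.

Let exp_taylor4 x : `|x| <= 1 -> exists2 r, `|r| <= 4 * `|x| ^+ 4 &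
  expR x = r + (1 + x + x ^+ 2 / 2 + x ^+ 3 / 6).
Proof.
move=> x1; exists (expR x - exp_poly 4 x); first exact: exp_taylor.
by rewrite -exp_poly4E subrK.
Qed.

Let nu_expansion eps u : 0 < eps -> eps <= 4^-1 -> eps <= u -> u <= 2 * eps ->
  u - eps = u * eps ^+ 2 ->
  `|u^-1 * (expR (- (2 * u)) * ((1 + eps) / 2) +
      expR (2 * u) * ((1 - eps) / 2) - 1) - 2 / 3 * (2 * eps ^+ 3)|
  <= 2 ^+ 12 * eps ^+ 4.
Proof.
move=> e0 e4 eu u2 ue; have u0 : 0 < u by apply: lt_le_trans eu.
have u0' := ltW u0; have e0' := ltW e0.
have x0 : 0 <= 2 * u by rewrite mulr_ge0.
have ee0 : 0 <= 2 * eps by rewrite mulr_ge0.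
have x1 : `|2 * u| <= 1 by rewrite (ger0_norm x0); lra.
have x1' : `|- (2 * u)| <= 1 by rewrite normrN.
have [r rE ->] := exp_taylor5 x1.
have [s sE ->] := exp_taylor5 x1'.
rewrite normrN in sE; rewrite (ger0_norm x0) in rE sE.
have u'0 : u != 0 by exact: lt0r_neq0.
set A := u^-1 * _ - _.
have -> : A = 2 * (u - eps) + 2 / 3 * u ^+ 3 - 4 / 3 * eps * u ^+ 2
    - 4 / 3 * eps ^+ 3 + u^-1 * (s * ((1 + eps) / 2) + r * ((1 - eps) / 2)).
  rewrite /A; transitivity (u^-1 * (u * (2 * (u - eps) + 2 / 3 * u ^+ 3
      - 4 / 3 * eps * u ^+ 2)) - 4 / 3 * eps ^+ 3
      + u^-1 * (s * ((1 + eps) / 2) + r * ((1 - eps) / 2))); last first.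
    by rewrite mulKf//; ring.
  have -> : 2 / 3 * (2 * eps ^+ 3) = 4 / 3 * eps ^+ 3 by field.
  by rewrite [RHS]addrAC -mulrDr; congr (_ * _ - _); field.
set B := u^-1 * _; rewrite ue.
(* The cubic vanishes at u = eps; its factor u - eps is again u eps^2, so the whole is of order
   eps^5. *)
have -> : 2 * (u * eps ^+ 2) + 2 / 3 * u ^+ 3 - 4 / 3 * eps * u ^+ 2
    - 4 / 3 * eps ^+ 3 =
    u * eps ^+ 2 * (2 / 3 * u ^+ 2 - 2 / 3 * eps * u + 4 / 3 * eps ^+ 2).
  transitivity ((u - eps) *
    (2 / 3 * u ^+ 2 - 2 / 3 * eps * u + 4 / 3 * eps ^+ 2)).
    by field.
  by rewrite ue.
have hB : `|B| <= 4 * (2 * u) ^+ 5 / u.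
  rewrite /B normrM gtr0_norm ?invr_gt0// mulrC ler_pM2r ?invr_gt0//.
  apply: (le_trans (ler_normD _ _)); rewrite (normrM s) (normrM r).
  rewrite (@ger0_norm _ ((1 + eps) / 2)); last by lra.
  rewrite (@ger0_norm _ ((1 - eps) / 2)); last by lra.
  have a1 : 0 <= (1 + eps) / 2 by lra.
  have a2 : 0 <= (1 - eps) / 2 by lra.
  have := ler_wpM2r a1 sE; have := ler_wpM2r a2 rE; lra.
have hB2 : 4 * (2 * u) ^+ 5 / u = 2 ^+ 7 * u ^+ 4 by field.
have u4 : u ^+ 4 <= (2 * eps) ^+ 4 by apply: lerXn2r; rewrite ?nnegrE.
have hA :
    `|u * eps ^+ 2 * (2 / 3 * u ^+ 2 - 2 / 3 * eps * u + 4 / 3 * eps ^+ 2)|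
    <= 2 * eps * eps ^+ 2 * (4 * eps ^+ 2).
  have uu : eps * eps <= eps * u by rewrite ler_pM2l.
  have uu1 : eps * u <= u * u by rewrite ler_pM2r.
  have uu2 : u * u <= 2 * eps * (2 * eps).
    by apply: ler_pM => //; exact: ltW.
  rewrite ger0_norm; last first.
    rewrite mulr_ge0 ?mulr_ge0 ?sqr_ge0 //.
    have := sqr_ge0 eps; lra.
  apply: ler_pM.
  - by rewrite mulr_ge0 ?sqr_ge0 //.
  - have := sqr_ge0 eps; lra.
  - by rewrite ler_pM2r ?exprn_gt0.
  - rewrite !expr2; have := mulr_ge0 (ltW e0) (ltW e0); lra.
apply: (le_trans (ler_normD _ _)); apply: (le_trans (lerD hA hB)).
rewrite hB2.
have e45 : eps ^+ 5 <= eps ^+ 4 * 4^-1 by rewrite exprSr ler_pM2l ?exprn_gt0.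
have u4' : 2 ^+ 7 * u ^+ 4 <= 2 ^+ 11 * eps ^+ 4.
  apply: (@le_trans _ _ (2 ^+ 7 * (2 * eps) ^+ 4)).
    by rewrite ler_pM2l// exprn_gt0.
  by rewrite exprMn mulrA -exprD.
have -> : 2 * eps * eps ^+ 2 * (4 * eps ^+ 2) = 8 * eps ^+ 5 by ring.
have -> : 2 ^+ 12 = 2 * 2 ^+ 11 :> R by rewrite -exprS.
have e4' : 0 <= eps ^+ 4 by rewrite exprn_ge0 //.
have p11 : 2 <= 2 ^+ 11 :> R by rewrite exprS ler_peMr// exprn_ege1// ler1n.
have := ler_wpM2r e4' p11; lra.
Qed.

Lemma nu_equiv : (fun eps : R => kappa_ eps / eps * nu eps)
  ~_((0 : R)^'+) (fun eps => 2 / 3 * (2 * eps ^+ 3)).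
Proof.
apply: (@equiv_at_right0 _ _ (2 ^+ 12)); first by rewrite exprn_gt0.
move=> eps e01; have [k0 ue eu u2] := ratio_bounds e01.
case/andP: e01 => e0 e4.
rewrite /nu -invf_div.
have -> : - 2 * eps / kappa_ eps = - (2 * (eps / kappa_ eps)) by ring.
have -> : 2 * eps / kappa_ eps = 2 * (eps / kappa_ eps) by rewrite mulrA.
apply: (le_trans (nu_expansion e0 e4 eu u2 ue)).
rewrite (exprS eps 3) mulrA; apply: ler_wpM2l.
  by apply: mulr_ge0; [exact: exprn_ge0 | exact: ltW].
have e3 : 0 <= eps ^+ 3 by rewrite exprn_ge0// ltW.
rewrite ger0_norm; lra.
Qed.

(** Constants cancel and the linear terms leave u - eps, of third order; the quadratic part u eps -
    2/3 u^2 yields the factor 1/3. *)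
Let rho_expansion eps u : 0 < eps -> eps <= 4^-1 -> eps <= u -> u <= 2 * eps ->
  u - eps = u * eps ^+ 2 ->
  `|u^-1 * ((expR (- (2 * u)) - 1) * ((1 + eps) / 2)) + 1 - 1 / 3 * eps ^+ 2|
  <= 2 ^+ 10 * eps ^+ 3.
Proof.
move=> e0 e4 eu u2 ue; have u0 : 0 < u by apply: lt_le_trans eu.
have u0' := ltW u0; have e0' := ltW e0.
have x0 : 0 <= 2 * u by rewrite mulr_ge0.
have ee0 : 0 <= 2 * eps by rewrite mulr_ge0.
have x1 : `|- (2 * u)| <= 1 by rewrite normrN (ger0_norm x0); lra.
have [r rE ->] := exp_taylor4 x1.
rewrite normrN (ger0_norm x0) in rE.
have u'0 : u != 0 by exact: lt0r_neq0.
set A := _ - _.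
have -> : A = (u - eps) * (- 2 / 3 * u + eps / 3) + (u - eps) -
    2 / 3 * eps * u ^+ 2 + r / u * ((1 + eps) / 2).
  by rewrite /A; field.
have hr : `|r / u * ((1 + eps) / 2)| <= 2 ^+ 6 * u ^+ 3.
  have -> : 2 ^+ 6 * u ^+ 3 = 4 * (2 * u) ^+ 4 / u * 1 by field.
  rewrite !normrM (@ger0_norm _ u^-1) ?invr_ge0 //.
  rewrite (@ger0_norm _ (1 + eps)); last by lra.
  rewrite (@ger0_norm _ 2^-1)//.
  apply: ler_pM => //; rewrite ?mulr_ge0 ?invr_ge0 //.
  - by lra.
  - by rewrite ler_pM2r ?invr_gt0.
  - by lra.
have u3 : u ^+ 3 <= (2 * eps) ^+ 3 by apply: lerXn2r; rewrite ?nnegrE.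
have e3 : 0 < eps ^+ 3 by rewrite exprn_gt0.
have d0 : 0 <= u - eps by rewrite subr_ge0.
have d1 : u - eps <= 2 * eps ^+ 3.
  rewrite ue (_ : 2 * eps ^+ 3 = 2 * eps * eps ^+ 2); last by ring.
  by rewrite ler_pM2r ?exprn_gt0.
have eu2 : eps * u ^+ 2 <= 4 * eps ^+ 3.
  rewrite (_ : 4 * eps ^+ 3 = eps * (2 * eps) ^+ 2); last by ring.
  by rewrite ler_pM2l//; apply: lerXn2r; rewrite ?nnegrE.
have eu0 : 0 <= eps * u ^+ 2 by rewrite mulr_ge0 ?sqr_ge0 //.
have w1 : - 1 <= - 2 / 3 * u + eps / 3 by lra.
have w2 : - 2 / 3 * u + eps / 3 <= 1 by lra.
have dw1 := ler_wpM2l d0 w1; have dw2 := ler_wpM2l d0 w2.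
have h1 : `|(u - eps) * (- 2 / 3 * u + eps / 3) + (u - eps)
    - 2 / 3 * eps * u ^+ 2| <= 8 * eps ^+ 3.
  by rewrite ler_norml; apply/andP; split; lra.
apply: (le_trans (ler_normD _ _)); apply: (le_trans (lerD h1 hr)).
have u3' : 2 ^+ 6 * u ^+ 3 <= 2 ^+ 9 * eps ^+ 3.
  apply: (@le_trans _ _ (2 ^+ 6 * (2 * eps) ^+ 3)).
    by rewrite ler_pM2l// exprn_gt0.
  by rewrite exprMn mulrA -exprD.
have -> : 2 ^+ 10 = 2 * 2 ^+ 9 :> R by rewrite -exprS.
have p9 : 8 <= 2 ^+ 9 :> R.
  have -> : 8 = 2 ^+ 3 :> R by rewrite -natrX.
  by rewrite ler_weXn2l// ler1n.
have := ler_wpM2r (ltW e3) p9; lra.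
Qed.

Lemma rho_equiv : (fun eps : R => kappa_ eps / eps * rho eps + 1)
  ~_((0 : R)^'+) (fun eps => 1 / 3 * eps ^+ 2).
Proof.
apply: (@equiv_at_right0 _ _ (2 ^+ 12)); first by rewrite exprn_gt0.
move=> eps e01; have [k0 ue eu u2] := ratio_bounds e01.
case/andP: e01 => e0 e4.
rewrite /rho -invf_div.
have -> : - 2 * eps / kappa_ eps = - (2 * (eps / kappa_ eps)) by ring.
apply: (le_trans (rho_expansion e0 e4 eu u2 ue)).
have e2 : 0 <= eps ^+ 2 by exact: sqr_ge0.
have e3 : 0 <= 2 ^+ 10 * eps ^+ 3.
  by apply: mulr_ge0; apply: exprn_ge0 => //; exact: ltW.
rewrite ger0_norm; last by rewrite mulr_ge0.
have -> : 2 ^+ 12 * eps * (1 / 3 * eps ^+ 2) = 4 / 3 * (2 ^+ 10 * eps ^+ 3).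
  by rewrite (exprD 2 2 10); field.
lra.
Qed.

End Asymptotics.

(* The source displays 2 eps^3 and eps^2 as the leading order terms. These are
   what the second order truncation of the exponentials gives; the third and
   fourth order terms contribute at the same orders and produce the numerical
   factors 2/3 and 1/3 below, without which the equivalences are false. *)
Theorem mainTheorem6 (R : realType) :
  (exists E1 : nat -> R -> R,
    [/\ (forall (T : nat) (eps : R), (1 <= T)%N -> 0 < eps < 1 ->
          `|ubar eps (kappa_ eps) (kappa_ eps) (kappa_ eps / eps)
              (eps * T%:R) 0 (- T%:R)
            - vbar eps T (eps * T%:R) 0| <= E1 T eps),
        (exists C : R, forall (T : nat) (eps : R), (1 <= T)%N -> 0 < eps < 1 ->
          `|E1 T eps| <= C * `|rate eps T|)
      & (exists C : R, \forall eps \near (0 : R)^'+, forall T : nat, (1 <= T)%N ->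
          `|E1 T eps| <= C * `|rate0 eps T|)]) /\
  ((fun eps : R => kappa_ eps / eps * nu eps)
     ~_((0 : R)^'+) (fun eps : R => 2 / 3 * (2 * eps ^+ 3))) /\
  ((fun eps : R => kappa_ eps / eps * rho eps + 1)
     ~_((0 : R)^'+) (fun eps : R => 1 / 3 * eps ^+ 2)).
Proof.
split; last by split; [exact: nu_equiv | exact: rho_equiv].
(* The gap itself serves as error term, so the content lies in the two rate bounds. *)
exists (fun T eps => value_gap eps T); split.
- by move=> T eps T1 e01; exact: lexx.
- exists (10 ^+ 3) => T eps T1 e01; rewrite normr_id.
  exact: value_gap_le_rate.
- exists (10 ^+ 3); near=> eps => T T1; rewrite normr_id.
  have e0 : 0 < eps by near: eps; exact: nbhs_right_gt.
  have e2 : eps <= 2^-1 by near: eps; apply: nbhs_right_le.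
  apply: value_gap_le_rate0 => //.
  by rewrite e0 (le_lt_trans e2)// invf_lt1// ltr1n.
Unshelve. all: by end_near.
Qed.
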